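(* Assume the following. (1) $X$ is bounded: there is $G>0$ with $\Vert X\Vert_d\le G$, where $\Vert\cdot\Vert_d$ is the Euclidean norm of $\mathbb{R}^d$. (2) The density $f$ of $Y$ is bounded. (3) $f$ and the $g_j$'s are $3$-times differentiable, and there exist a neighborhood $U$ of the origin in $\mathbb{R}$ and a constant $c>0$ such that, for any $u\in U$, any $y\in\mathbb{R}$ and $j=1,\dots,d$, $|f^{(3)}(y+u)-f^{(3)}(y)|\le c|u|$ and $|g_j^{(3)}(y+u)-g_j^{(3)}(y)|\le c|u|$. (4) For any $1\le k,\ell\le d$, any $u\in U$ and any $y\in\mathbb{R}$, $|R_k(y+u)R_\ell(y+u)-R_k(y)R_\ell(y)|\le c|u|$. (5) There exist an integer $r>6$, $\alpha\in\,]0,1]$ and $L>0$ with $\beta:=r+\alpha>7$ such that, for every $j\in\{1,\dots,d\}$, $g_j$ is $r$-times differentiable and $|g_j^{(r)}(x)-g_j^{(r)}(y)|\le L|x-y|^{\alpha}$ for all $x,y\in\mathbb{R}$. (6) The kernel $K$ satisfies: (i) $K$ is continuous and its support is $[-1,1]$; (ii) $K$ is symmetric about $0$; (iii) $\sup_{u\in\mathbb{R}}|K(u)|<+\infty$; (iv) $K$ is of order $r$, that is $\int u^kK(u)\,du=0$ for $k\in\{1,2,\dots,r\}$; (v) $\int|K(u)|\,du<+\infty$ and $\int|u|^{\beta}|K(u)|\,du<+\infty$. (7) $h_n\sim n^{-c_1}$ and $b_n\sim n^{-c_2}$ as $n\to+\infty$, where $c_1>0$, $0<c_2<1/10$ and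 $1/8+c_2/4<c_1<1/4-c_2$. Then $\widehat\Lambda_n$ converges almost surely to $\Lambda$, as $n\to+\infty$.
   Context: Let $1\le N<d$ be integers and consider the regression model $Y=F(\beta_1^TX,\dots,\beta_N^TX,\varepsilon)$, where $X=(X^{(1)},\dots,X^{(d)})^T$ is a random vector of $\mathbb{R}^d$ with covariance matrix equal to the identity, $\beta_1,\dots,\beta_N\in\mathbb{R}^d$, $\varepsilon$ is a real random variable independent of $X$, and $F$ is an arbitrary unknown function on $\mathbb{R}^{N+1}$. The real random variable $Y$ has a density $f$ with $f(y)>0$ for all $y\in\mathbb{R}$, and for $j=1,\dots,d$ the pair $(X^{(j)},Y)$ has a density $f_{(X^{(j)},Y)}$. Put $$g_j(y)=\int_{\mathbb{R}}z\,f_{(X^{(j)},Y)}(z,y)\,dz,\qquad R_j(y)=\mathbb{E}(X^{(j)}\mid Y=y)=\frac{g_j(y)}{f(y)},$$ $R(Y)=(R_1(Y),\dots,R_d(Y))^T=\mathbb{E}(X\mid Y)$, and let $\Lambda=Cov(\mathbb{E}(X\mid Y))$ be its covariance matrix. Let $(Y_i,X_i)_{i=1,\dots,n}$ be an i.i.d. sample of $(Y,X)$, with $X_i=(X_{i1},\dots,X_{id})^T$. Let $K:\mathbb{R}\to\mathbb{R}$ be a kernel function (in the usual sense, $\int K(u)\,du=1$), $(h_n)$ a bandwidth sequence of positive reals, and $(b_n)$ a sequence of positive reals with $\lim_{n\to+\infty} b_n=0$. Define $$\widehat f_n(y)=\frac1n\sum_{i=1}^n\frac1{h_n}K\Big(\frac{y-Y_i}{h_n}\Big),\qquad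 \widehat g_{j,n}(y)=\frac1n\sum_{i=1}^nX_{ij}\frac1{h_n}K\Big(\frac{y-Y_i}{h_n}\Big),$$ $\widehat f_{b_n}(y)=\max(\widehat f_n(y),b_n)$, $\widehat R_{b_n,j}(y)=\widehat g_{j,n}(y)/\widehat f_{b_n}(y)$, $\widehat R_{b_n}(y)=(\widehat R_{b_n,1}(y),\dots,\widehat R_{b_n,d}(y))^T$, and $$\widehat\Lambda_n=\frac1n\sum_{i=1}^n\widehat R_{b_n}(Y_i)\,\widehat R_{b_n}(Y_i)^T.$$ Notation: $u_n\sim v_n$ means that $u_n/v_n$ converges to a finite, strictly positive constant.
   Formalization: The formal theorem additionally assumes that X is centred, E(X)=0; without this the uncentred estimator converges to Λ+E(X)E(X)^T, so the claim as stated fails whenever E(X)≠0. *)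

(* Defs.v *)
From HB Require Import structures.
From mathcomp Require Import all_boot all_order all_algebra.
From mathcomp Require Import all_classical all_reals all_analysis.

Set Implicit Arguments.
Unset Strict Implicit.
Unset Printing Implicit Defensive.

Import Order.TTheory GRing.Theory Num.Theory.
Import numFieldNormedType.Exports.

Local Open Scope classical_set_scope.
Local Open Scope ring_scope.

Section probability_notions.
Context (disp : measure_display) (Omega : measurableType disp) (R : realType).
Variable P : probability Omega R.

Definition independent_pair (d1 d2 : measure_display)
    (S1 : measurableType d1) (S2 : measurableType d2)
    (Z1 : Omega -> S1) (Z2 : Omega -> S2) : Prop :=
  forall A B, measurable A -> measurable B ->
    P (Z1 @^-1` A `&` Z2 @^-1` B) = (P (Z1 @^-1` A) * P (Z2 @^-1` B))%E.

Definition mutually_independent (d1 : measure_display)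
    (S : measurableType d1) (Z : nat -> Omega -> S) : Prop :=
  forall (J : seq nat) (A : nat -> set S), uniq J ->
    (forall i, measurable (A i)) ->
    P (\bigcap_(i in [set` J]) (Z i @^-1` A i)) =
    (\prod_(i <- J) P (Z i @^-1` A i))%E.

Definition same_law (d1 : measure_display) (S : measurableType d1)
    (Z1 Z2 : Omega -> S) : Prop :=
  forall A, measurable A -> P (Z1 @^-1` A) = P (Z2 @^-1` A).

Definition iid_sample (d1 : measure_display) (S : measurableType d1)
    (Z : Omega -> S) (Zs : nat -> Omega -> S) : Prop :=
  mutually_independent Zs /\ forall i, same_law (Zs i) Z.

Definition density_of (d1 : measure_display) (S : measurableType d1)
    (mu : set S -> \bar R) (Z : Omega -> S) (f : S -> R) : Prop :=
  [/\ measurable_fun setT f, (forall s, 0 <= f s) &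
      forall A, measurable A ->
        P (Z @^-1` A) = (\int[mu]_(s in A) (f s)%:E)%E].

(* [m] is a version of y |-> E(V | Y = y). *)
Definition is_condexp (V Y : Omega -> R) (m : R -> R) : Prop :=
  [/\ measurable_fun setT m, P.-integrable setT (EFin \o (m \o Y)) &
      forall B : set R, measurable B ->
        (\int[P]_(w in Y @^-1` B) (m (Y w))%:E)%E =
        (\int[P]_(w in Y @^-1` B) (V w)%:E)%E].

(* A chosen version of y |-> E(V | Y = y); versions agree almost everywhere
   for the law of Y. The default value 0 is only used if there is none. *)
Definition condexp (V Y : Omega -> R) : R -> R :=
  xget (fun=> 0) [set m | is_condexp V Y m].

Definition covmx (d : nat) (V : 'I_d -> Omega -> R) : 'M[R]_d :=
  \matrix_(j, k) fine (covariance P (V j) (V k)).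

(* Random vectors take values in [d.-tuple R], which carries the product
   sigma-algebra; [coordinate X j] is the j-th component X^(j). *)
Definition coordinate (d : nat) (X : Omega -> d.-tuple R) (j : 'I_d) :
  Omega -> R := fun w => tnth (X w) j.

Definition Lambda (d : nat) (X : Omega -> d.-tuple R) (Y : Omega -> R) :
  'M[R]_d := covmx (fun j w => condexp (coordinate X j) Y (Y w)).

End probability_notions.

Section real_functions.
Context (R : realType).

Definition col_of_tuple (d : nat) (x : d.-tuple R) : 'cV[R]_d :=
  \col_j tnth x j.

Definition enorm (d : nat) (x : 'cV[R]_d) : R :=
  Num.sqrt (\sum_j x j 0 ^+ 2).

Definition times_derivable (n : nat) (f : R -> R) : Prop :=
  forall k, (k < n)%N -> forall y, derivable (derive1n k f) y 1.

Definition support_of (K : R -> R) : set R := closure [set u | K u != 0].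

Definition asymp (u v : nat -> R) : Prop :=
  exists2 l : R, 0 < l & (fun n => u n / v n) @ \oo --> l.

Definition gfun (fXY : R * R -> R) (y : R) : R :=
  \int[lebesgue_measure]_z (z * fXY (z, y)).

End real_functions.

(* The sample is indexed from 0: the first n observations are those with
   index i < n. [ys] and [xs] are realisations of the sample. *)
Section estimators.
Context (R : realType) (d : nat).
Variables (K : R -> R) (h b : nat -> R).
Variables (ys : nat -> R) (xs : nat -> d.-tuple R).

Definition fhat (n : nat) (y : R) : R :=
  n%:R^-1 * \sum_(i < n) (h n)^-1 * K ((y - ys i) / h n).

Definition ghat (n : nat) (j : 'I_d) (y : R) : R :=
  n%:R^-1 * \sum_(i < n) tnth (xs i) j * (h n)^-1 * K ((y - ys i) / h n).

Definition fhat_b (n : nat) (y : R) : R := Num.max (fhat n y) (b n).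

Definition Rhat (n : nat) (y : R) : 'cV[R]_d :=
  \col_j (ghat n j y / fhat_b n y).

Definition Lambdahat (n : nat) : 'M[R]_d :=
  n%:R^-1 *: \sum_(i < n) (Rhat n (ys i) *m (Rhat n (ys i))^T).

End estimators.

(* Main.v *)
(** Put b = b_n, h = h_n. After clipping the (a.s. bounded) X_i, fix a sample
    point Y_i: the difference between the kernel estimate at Y_i and its
    conditional mean given Y_i is an average of variables of size O(1/h) that are
    centered given Y_i, because every other observation is independent of Y_i.
    Its fourth moment is therefore O(n^-2 h^-4), and the conditional mean differs
    from the target by O(h^4) (third order Taylor expansion, vanishing moments
    of K). As 4 (c1 + c2) < 1, the expectations of (1/n) sum_i (error_i / b)^4
    are summable, so these averages tend to 0 a.s.
    Only averages over the sample points enter, so no uniform convergence (hence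
    no modulus of continuity of K) is needed. On the other hand
    |R^_k R^_l - R_k R_l| at Y_i is bounded by a polynomial in error_i / b plus
    G^2 times the indicator of f(Y_i) < b, and the strong law takes care of these
    indicators and of (1/n) sum_i R_k(Y_i) R_l(Y_i). *)

Require Import Defs.
From HB Require Import structures.
From mathcomp Require Import all_boot all_order all_algebra.
From mathcomp Require Import all_classical all_reals all_analysis.
From mathcomp Require Import measurable_realfun.
From mathcomp Require Import ring lra.

Set Implicit Arguments.
Unset Strict Implicit.
Unset Printing Implicit Defensive.

Import Order.TTheory GRing.Theory Num.Theory.
Import numFieldNormedType.Exports.

Local Open Scope classical_set_scope.
Local Open Scope ring_scope.

(** * Expectations of bounded functions and independence *)

Section bounded_functions.
Context {d : measure_display} {T : measurableType d} {R : realType}.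
Implicit Types f g : T -> R.

(** The fourth moment is forced: a second moment would leave n^-1 h^-2 b^-2, which is never summable
    when h and b tend to 0, and there is no freedom to pass to a subsequence. Each [Y_i] is both an
    evaluation point and an observation. It is frozen by Fubini: a new observation [Z m] with [m]
    different from [i] is independent of everything generated by [Z i] and the [Z k], k < m, so its
    centered term is orthogonal to powers of the partial sum. The diagonal term is kept apart. All
    these computations use functions bounded at every point, so that integrability is automatic; as
    X is bounded only almost surely, it is clipped. [Lambda] is built from an unspecified version of
    E(X | Y). The quotient g_j / f is another version, hence agrees with it almost surely, and it
    inherits the bound G of X; this gives |g_j| <= G f at the sample points, which keeps the
    truncated ratios bounded. Since X is centered, so is E(X | Y), and the covariance is the plain
    second moment that averages of products estimate. *)

Definition bounded_measurable f :=
  measurable_fun setT f /\ exists M, forall x, `|f x| <= M.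

Lemma bounded_measurable_cst (a : R) : bounded_measurable (fun=> a).
Proof. by split; [exact: measurable_cst|exists `|a|]. Qed.

Lemma bounded_measurableD f g : bounded_measurable f -> bounded_measurable g ->
  bounded_measurable (fun x => f x + g x).
Proof.
move=> [mf [M hM]] [mg [N hN]]; split; first exact: measurable_funD.
by exists (M + N) => x; rewrite (le_trans (ler_normD _ _))// lerD.
Qed.

Lemma bounded_measurableM f g : bounded_measurable f -> bounded_measurable g ->
  bounded_measurable (fun x => f x * g x).
Proof.
move=> [mf [M hM]] [mg [N hN]]; split; first exact: measurable_funM.
by exists (M * N) => x; rewrite normrM ler_pM.
Qed.

Lemma bounded_measurableX f n : bounded_measurable f ->
  bounded_measurable (fun x => f x ^+ n).
Proof.
move=> bf; elim: n => [|n ih]; first exact: bounded_measurable_cst.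
rewrite (_ : (fun x => _) = (fun x => f x * f x ^+ n)); last first.
  by apply/funext => x; rewrite exprS.
exact: bounded_measurableM.
Qed.

Lemma bounded_measurable_sum (I : Type) (s : seq I) (Q : pred I) (F : I -> T -> R) :
  (forall i, bounded_measurable (F i)) ->
  bounded_measurable (fun x => \sum_(i <- s | Q i) F i x).
Proof.
move=> bF; elim: s => [|i s ih].
  rewrite (_ : (fun _ => _) = fun=> 0); first exact: bounded_measurable_cst.
  by apply/funext => x; rewrite big_nil.
have [Qi|Qi] := boolP (Q i).
  rewrite (_ : (fun _ => _) = fun x => F i x + \sum_(j <- s | Q j) F j x).
    exact: bounded_measurableD.
  by apply/funext => x; rewrite big_cons Qi.
rewrite (_ : (fun _ => _) = fun x => \sum_(j <- s | Q j) F j x) //.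
by apply/funext => x; rewrite big_cons (negbTE Qi).
Qed.

Lemma bounded_measurableN f : bounded_measurable f ->
  bounded_measurable (fun x => - f x).
Proof.
move=> [mf [M hM]]; split; first exact: measurableT_comp.
by exists M => x; rewrite normrN.
Qed.

Lemma bounded_measurableB f g : bounded_measurable f -> bounded_measurable g ->
  bounded_measurable (fun x => f x - g x).
Proof. by move=> bf bg; apply/bounded_measurableD/bounded_measurableN. Qed.

Lemma bounded_measurable_integrable_lty (mu : {measure set T -> \bar R}) f :
  (mu setT < +oo)%E -> bounded_measurable f -> mu.-integrable setT (EFin \o f).
Proof.
move=> muoo [mf [M hM]]; apply: measurable_bounded_integrable => //.
by exists M; split; [exact: num_real|move=> x Mx y _; exact: le_trans (ltW Mx)].
Qed.

Lemma bounded_measurable_integrable (P : probability T R) f :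
  bounded_measurable f -> P.-integrable setT (EFin \o f).
Proof.
apply: bounded_measurable_integrable_lty.
by have /= -> := probability_setT P; exact: ltry.
Qed.

End bounded_functions.

Lemma bounded_measurable_comp {d d' : measure_display} {T : measurableType d}
    {T' : measurableType d'} {R : realType} (W : T' -> T) (f : T -> R) :
  measurable_fun setT W -> bounded_measurable f -> bounded_measurable (f \o W).
Proof.
by move=> mW [mf [M hM]]; split; [exact: measurableT_comp|exists M => x /=].
Qed.

Section expectation.
Context {d : measure_display} {T : measurableType d} {R : realType}.
Variable P : probability T R.
Implicit Types f g : T -> R.

Lemma bounded_RintegralD f g : bounded_measurable f -> bounded_measurable g ->
  \int[P]_x (f x + g x) = \int[P]_x f x + \int[P]_x g x.
Proof. by move=> bf bg; rewrite RintegralD//; exact: bounded_measurable_integrable. Qed.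

Lemma bounded_RintegralZ f a : bounded_measurable f ->
  \int[P]_x (a * f x) = a * \int[P]_x f x.
Proof. by move=> bf; rewrite RintegralZl//; exact: bounded_measurable_integrable. Qed.

Lemma bounded_le_Rintegral f g : bounded_measurable f -> bounded_measurable g ->
  (forall x, f x <= g x) -> \int[P]_x f x <= \int[P]_x g x.
Proof.
by move=> bf bg fg; apply: le_Rintegral => //; exact: bounded_measurable_integrable.
Qed.

Lemma Rintegral_probability_cst (a : R) : \int[P]_x a = a.
Proof.
rewrite Rintegral_cst //; have /= -> := probability_setT P.
exact: mulr1.
Qed.

Lemma bounded_Rintegral_sum (I : Type) (s : seq I) (F : I -> T -> R) :
  (forall i, bounded_measurable (F i)) ->
  \int[P]_x (\sum_(i <- s) F i x) = \sum_(i <- s) \int[P]_x F i x.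
Proof.
move=> bF; elim: s => [|i s ih].
  under eq_Rintegral do rewrite big_nil; rewrite big_nil.
  exact: Rintegral_probability_cst.
under eq_Rintegral do rewrite big_cons.
by rewrite big_cons bounded_RintegralD ?ih//; exact: bounded_measurable_sum.
Qed.

Lemma bounded_Rintegral_EFin f : bounded_measurable f ->
  ((\int[P]_x f x)%:E = \int[P]_x (f x)%:E)%E.
Proof.
move=> bf; rewrite /Rintegral fineK//.
by apply: integrable_fin_num => //; exact: bounded_measurable_integrable.
Qed.

End expectation.

Section independence.
Context {d : measure_display} {T : measurableType d} {R : realType}.
Variable P : probability T R.
Context {d1 d2 : measure_display} {S1 : measurableType d1} {S2 : measurableType d2}.

Lemma same_law_Rintegral (Z1 Z2 : T -> S1) (f : S1 -> R) :
  measurable_fun setT Z1 -> measurable_fun setT Z2 -> same_law P Z1 Z2 ->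
  bounded_measurable f ->
  \int[P]_w f (Z1 w) = \int[P]_w f (Z2 w).
Proof.
move=> m1 m2 h12 bf.
pose Z1' : {mfun T >-> S1} := HB.pack Z1 (isMeasurableFun.Build _ _ _ _ Z1 m1).
pose Z2' : {mfun T >-> S1} := HB.pack Z2 (isMeasurableFun.Build _ _ _ _ Z2 m2).
have [b1 b2] := (bounded_measurable_comp m1 bf, bounded_measurable_comp m2 bf).
rewrite /Rintegral; congr fine.
have mf : measurable_fun setT (EFin \o f) by apply/measurable_EFinP; case: bf.
have := @integral_distribution _ _ _ _ _ P Z1' (EFin \o f) mf
  (bounded_measurable_integrable P b1).
have := @integral_distribution _ _ _ _ _ P Z2' (EFin \o f) mf
  (bounded_measurable_integrable P b2).
rewrite /= => <- <-; apply: eq_measure_integral => A mA _.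
exact: h12.
Qed.

(** Independence makes the joint law the product of the marginals, and Fubini integrates over [Z]
    first, with [W] frozen at [s]. This takes the place of conditioning on [W]. *)
Lemma independent_Rintegral0 (W : T -> S1) (Z : T -> S2) (F : S1 * S2 -> R) :
  measurable_fun setT W -> measurable_fun setT Z -> independent_pair P W Z ->
  bounded_measurable F -> (forall s, \int[P]_w F (s, Z w) = 0) ->
  \int[P]_w F (W w, Z w) = 0.
Proof.
move=> mW mZ ind bF F0.
pose W' : {mfun T >-> S1} := HB.pack W (isMeasurableFun.Build _ _ _ _ W mW).
pose Z' : {mfun T >-> S2} := HB.pack Z (isMeasurableFun.Build _ _ _ _ Z mZ).
have mWZ : measurable_fun setT (fun w => (W w, Z w)) by exact: measurable_fun_pair.
pose WZ : {mfun T >-> (S1 * S2)%type} :=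
  HB.pack (fun w => (W w, Z w)) (isMeasurableFun.Build _ _ _ _ _ mWZ).
have mF : measurable_fun setT (EFin \o F) by apply/measurable_EFinP; case: bF.
have bWZ := bounded_measurable_comp mWZ bF.
have PWoo : ((distribution P W' \x distribution P Z')%E setT < +oo)%E.
  rewrite -setXTT product_measure1E//.
  have /= -> := probability_setT (distribution P W').
  have /= -> := probability_setT (distribution P Z').
  by rewrite mul1e ltry.
rewrite /Rintegral.
have -> : (\int[P]_w (F (W w, Z w))%:E =
    \int[distribution P W' \x distribution P Z']_y (EFin \o F) y)%E.
  have := @integral_distribution _ _ _ _ _ P WZ (EFin \o F) mF
    (bounded_measurable_integrable P bWZ).
  rewrite /= => <-; apply: eq_measure_integral => A mA _.
  by apply/esym; apply: product_measure_unique => // B C mB mC; exact: ind.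
rewrite -integral12_prod_meas1/=; last exact: bounded_measurable_integrable_lty.
rewrite integral0_eq// => s _; rewrite /fubini_F.
have bFs : @bounded_measurable _ S2 R (fun z => F (s, z)).
  case: bF => mF' [M hM]; split; last by exists M.
  exact/measurableT_comp/measurable_pair1.
have ms : measurable_fun setT (EFin \o (fun z => F (s, z))).
  by apply/measurable_EFinP; case: bFs.
have := @integral_distribution _ _ _ _ _ P Z' _ ms
  (bounded_measurable_integrable P (bounded_measurable_comp mZ bFs)).
rewrite /= => ->.
have := bounded_Rintegral_EFin P (bounded_measurable_comp mZ bFs).
by rewrite F0 => <-.
Qed.

End independence.

(** * Moments of centered sums *)

Section clip.
Context {R : realType}.

(** For [0 <= M], the projection onto [-M, M]: it turns an almost sure bound into a bound at every
    point and alters the variable only on a null set. *)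
Definition clip (M x : R) : R := Num.max (- M) (Num.min M x).

Lemma clip_id M x : `|x| <= M -> clip M x = x.
Proof.
move=> xM; have [Mx xM'] : - M <= x /\ x <= M by apply/andP; rewrite -ler_norml.
by rewrite /clip (min_idPr xM') (max_idPr Mx).
Qed.

Lemma clip_le M x : 0 <= M -> `|clip M x| <= M.
Proof.
move=> M0; rewrite ler_norml /clip le_max lexx/= ge_max ge_min lexx/= andbT.
by rewrite (le_trans _ M0)// oppr_le0.
Qed.

Lemma measurable_clip M : measurable_fun setT (clip M).
Proof. by apply: measurable_maxr => //; exact: measurable_minr. Qed.

Lemma bounded_measurable_clip d (T : measurableType d) M (f : T -> R) : 0 <= M ->
  measurable_fun setT f -> bounded_measurable (fun x => clip M (f x)).
Proof.
move=> M0 mf; split; last by exists M => x; exact: clip_le.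
by apply: measurableT_comp => //; exact: measurable_clip.
Qed.

End clip.

(** * Independence of one observation from a sub-family of the others *)

Section past_sigma_algebra.
Context {d : measure_display} {T : measurableType d} {R : realType}.
Variable P : probability T R.
Context {d1 : measure_display} {S : measurableType d1}.
Variable Z : nat -> T -> S.
Hypothesis mZ : forall i, measurable_fun setT (Z i).
Hypothesis indZ : mutually_independent P Z.

(* [cylinders J] generates the sigma-algebra of the [Z j] with [j] in [J]. *)
Definition cylinders (J : set nat) : set (set T) :=
  [set C | exists (s : seq nat) (A : nat -> set S), [/\ uniq s, [set` s] `<=` J,
     forall i, measurable (A i) & C = \bigcap_(i in [set` s]) (Z i @^-1` A i)]].

Local Notation past J := (g_sigma_algebraType (cylinders J)).

Lemma measurable_cylinders J : cylinders J `<=` measurable.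
Proof.
move=> _ [s [A [us sJ mA ->]]]; apply: bigcap_measurableType => i _.
by rewrite -[X in measurable X]setTI; exact: mZ.
Qed.

Lemma cylinders_setI_closed J : setI_closed (cylinders J).
Proof.
move=> _ _ [s [A [us sJ mA ->]]] [t [B [ut tJ mB ->]]].
(* A cylinder is indexed by a duplicate-free list, hence [undup]; an index missing from one of the
   lists is padded with the whole space. *)
exists (undup (s ++ t)), (fun i => (if i \in s then A i else setT) `&`
  (if i \in t then B i else setT)); split; first exact: undup_uniq.
- by move=> i /=; rewrite mem_undup mem_cat => /orP[/sJ|/tJ].
- by move=> i; apply: measurableI; case: ifP.
- apply/seteqP; split=> [w [wA wB] i /= _|w wAB].
    by split; case: ifP => // ?; [exact: wA|exact: wB].
  split=> i /= si.
    by have := wAB i; rewrite /= mem_undup mem_cat si => /(_ erefl)[].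
  by have := wAB i; rewrite /= mem_undup mem_cat si orbT => /(_ erefl)[].
Qed.

Lemma cylindersT J : cylinders J setT.
Proof.
exists [::], (fun=> setT); split => //.
by rewrite set_nil bigcap_set0.
Qed.

Lemma measurable_past J i : J i -> @measurable_fun _ _ (past J) S setT (Z i).
Proof.
move=> Ji _ A mA; apply: sub_sigma_algebra; exists [:: i], (fun=> A); split => //.
  by move=> j; rewrite /= inE => /eqP ->.
by rewrite setTI set_cons1 bigcap_set1.
Qed.

(** With E = {Z a in B}, the finite measures C -> P(C and E) and C -> P(E) P(C) agree on the
    cylinders, which are stable under intersection, hence on the sigma-algebra they generate. The
    set [J] is arbitrary because it will contain the index of the evaluation point besides an
    initial segment. *)
Lemma past_independent d2 (S2 : measurableType d2) (W : T -> S2) J a :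
  ~ J a -> @measurable_fun _ _ (past J) S2 setT W -> independent_pair P W (Z a).
Proof.
move=> Ja mW A B mA mB.
have mE : measurable (Z a @^-1` B) by rewrite -[X in measurable X]setTI; exact: mZ.
pose E := Z a @^-1` B.
have PE : P E = (fine (P E))%:E by rewrite fineK// fin_num_measure.
pose p : {nonneg R} := NngNum (fine_ge0 (measure_ge0 P E)).
suff : mrestr P mE (W @^-1` A) = mscale p P (W @^-1` A).
  by rewrite /mrestr /mscale /= -PE muleC.
apply: (g_sigma_algebra_measure_unique (cylinders J) (@measurable_cylinders J)
  (fun=> setT) (fun=> cylindersT J) _ (mrestr P mE) (mscale p P)
  (@cylinders_setI_closed J)).
- exact: bigcup_const.
- move=> _ [s [C [us sJ mC ->]]]; rewrite /= /mrestr /mscale/= -PE.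
  have sa : a \notin s by apply/negP => /sJ.
  have sne i : i \in s -> (i == a) = false.
    by move=> si; apply/negbTE; apply: contraNneq sa => <-.
  (* Mutual independence is used for the list enlarged by [a], with [B] as the event at [a], and
     then compared with the list [s] alone. *)
  have := @indZ (a :: s) (fun i => if i == a then B else C i).
  rewrite /= sa => /(_ us) ind1.
  have mC' i : measurable (if i == a then B else C i) by case: ifP.
  have {ind1} := ind1 mC'; rewrite big_cons eqxx.
  rewrite (eq_big_seq (fun i => P (Z i @^-1` C i))); last first.
    by move=> i /sne ->.
  rewrite -(indZ us mC) => <-; congr (P _).
  apply/seteqP; split=> [w [wC wB] i /=|w wBC].
    by rewrite inE; case: eqVneq => [-> _|_ /= si]; [|exact: wC].
  split=> [i /= si|].
    by have := wBC i; rewrite /= inE si orbT (sne _ si); exact.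
  by have := wBC a; rewrite /= inE eqxx; exact.
- move=> k; rewrite /= /mrestr (le_lt_trans (probability_le1 P _)) ?ltry//.
  exact: measurableI.
- by have := mW measurableT A mA; rewrite setTI.
Qed.

End past_sigma_algebra.

Ltac solve_bounded_measurable :=
  solve [repeat first [ assumption | exact: bounded_measurable_cst
    | apply: bounded_measurableX | apply: bounded_measurableD
    | apply: bounded_measurableM ]].

Section moments.
Context {d : measure_display} {T : measurableType d} {R : realType}.
Variable P : probability T R.
Context {d1 : measure_display} {S : measurableType d1}.
Variable Z : nat -> T -> S.
Hypothesis mZ : forall i, measurable_fun setT (Z i).
Hypothesis indZ : mutually_independent P Z.
Variables (psi : S * S -> R) (B : R).
Hypothesis mpsi : measurable_fun setT psi.
Hypothesis psiB : forall s, `|psi s| <= B.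
Hypothesis psi0 : forall k s, \int[P]_w psi (s, Z k w) = 0.
Variable i : nat.

(** The diagonal term is replaced by 0: [psi0] centers [psi] for a frozen first argument and says
    nothing about [psi (Z i w, Z i w)]. *)
Let phi k w := if k == i then 0 else psi (Z i w, Z k w).
Let Sum m w := \sum_(k < m) phi k w.

Let SumS m w : Sum m.+1 w = Sum m w + phi m w.
Proof. by rewrite /Sum big_ord_recr. Qed.

Let bphi k : bounded_measurable (phi k).
Proof.
rewrite /phi; case: eqP => _; first exact: bounded_measurable_cst.
split; last by exists B.
by apply: measurableT_comp => //; exact: measurable_fun_pair.
Qed.

Let bSum m : bounded_measurable (Sum m).
Proof. exact: bounded_measurable_sum. Qed.

Let B0 : 0 <= B.
Proof. exact: le_trans (psiB (Z 0 point, Z 0 point)). Qed.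

Let phiB k w : `|phi k w| <= B.
Proof. by rewrite /phi; case: eqP => // _; rewrite normr0. Qed.

Let SumB m w : `|Sum m w| <= m%:R * B.
Proof.
rewrite (le_trans (ler_norm_sum _ _ _))//.
rewrite (le_trans (ler_sum _ (fun (k : 'I_m) _ => phiB k w)))//.
by rewrite sumr_const card_ord mulr_natl.
Qed.

(** Orthogonality of a new term to the past: [Z i] and [Sum m] are measurable for the indices in
    [J], which avoids [m] unless m = i, and in that case [phi m] is 0. *)
Let Sum_phi0 m n : \int[P]_w (Sum m w ^+ n * phi m w) = 0.
Proof.
rewrite /phi; have [->|mi] := eqVneq m i.
  by under eq_Rintegral do rewrite mulr0; exact: Rintegral_probability_cst.
pose W w := (Z i w, Sum m w).
pose J := [set k | k = i \/ (k < m)%N].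
have mphi k : (k < m)%N ->
    @measurable_fun _ _ (g_sigma_algebraType (cylinders Z J)) R setT (phi k).
  move=> km; rewrite /phi; case: eqP => [_|_]; first exact: measurable_cst.
  apply: measurableT_comp => //; apply: measurable_fun_pair.
    by apply: measurable_past; left.
  by apply: measurable_past; right.
have mW : @measurable_fun _ _ (g_sigma_algebraType (cylinders Z J)) _ setT W.
  apply: measurable_fun_pair; first by apply: measurable_past; left.
  by apply: measurable_sum => k; exact: mphi.
have Jm : ~ J m by move=> [/eqP|]; rewrite ?(negbTE mi) ?ltnn.
have ind := past_independent mZ indZ Jm mW.
have mW' : measurable_fun setT W.
  by apply: measurable_fun_pair => //; case: (bSum m).
(* The clip makes [F] bounded on the whole product space; by [SumB] it changes nothing at the values
   taken by [Sum m]. *)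
pose F (p : (S * R) * S) := clip (m%:R * B) p.1.2 ^+ n * psi (p.1.1, p.2).
have bF : bounded_measurable F.
  apply: bounded_measurableM.
    apply: bounded_measurableX; apply: bounded_measurable_clip.
      by rewrite mulr_ge0.
    by apply: (measurableT_comp measurable_snd); exact: measurable_fst.
  split; last by exists B => -[].
  apply: measurableT_comp => //; apply: measurable_fun_pair => //.
  by apply: (measurableT_comp measurable_fst); exact: measurable_fst.
have := independent_Rintegral0 mW' (mZ m) ind bF.
rewrite /F/= => FW0; rewrite -[RHS]FW0 => [|[s x]] /=.
  by apply: eq_Rintegral => w _; rewrite clip_id.
rewrite bounded_RintegralZ ?psi0 ?mulr0//; split; last by exists B.
by apply: measurableT_comp => //; exact: measurable_fun_pair.
Qed.

Lemma centered_second_moment m : \int[P]_w (Sum m w ^+ 2) <= m%:R * B ^+ 2.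
Proof.
elim: m => [|m ih].
  under eq_Rintegral do rewrite /Sum big_ord0 expr0n/=.
  by rewrite Rintegral_probability_cst mul0r.
under eq_Rintegral do rewrite SumS.
have bS := bSum m; have bp := bphi m.
rewrite (@le_trans _ _ (\int[P]_w ((Sum m w ^+ 2 + B ^+ 2) + 2 * (Sum m w ^+ 1 * phi m w))))//.
  apply: bounded_le_Rintegral.
  - solve_bounded_measurable.
  - solve_bounded_measurable.
  - move=> w; have : phi m w ^+ 2 <= B ^+ 2.
      by rewrite -(real_normK (num_real (phi m w))) ler_pXn2r// nnegrE.
    rewrite expr1; move: (Sum m w) (phi m w) => s p hp.
    have -> : (s + p) ^+ 2 = s ^+ 2 + p ^+ 2 + 2 * (s * p) by ring.
    by rewrite lerD2r lerD2l.
rewrite !bounded_RintegralD ?bounded_RintegralZ ?Sum_phi0; last first.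
all: try solve_bounded_measurable.
by rewrite Rintegral_probability_cst mulr0 addr0 -natr1 mulrDl mul1r lerD2r.
Qed.

(** In the expansion of (s + p)^4 the term s^3 p integrates to 0, and 4 s p^3 <= 2 s^2 p^2 + 2 p^4
    absorbs the other odd term, so a step adds at most 8 B^2 s^2 + 3 B^4. By the second moment bound
    its mean is at most (8 m + 3) B^4, which is below the increment 8 m + 4 of 4 m^2 times B^4. *)
Lemma centered_fourth_moment m :
  \int[P]_w (Sum m w ^+ 4) <= 4 * m%:R ^+ 2 * B ^+ 4.
Proof.
elim: m => [|m ih].
  under eq_Rintegral do rewrite /Sum big_ord0 expr0n/=.
  by rewrite Rintegral_probability_cst expr0n/= mulr0 mul0r.
under eq_Rintegral do rewrite SumS.
have bS := bSum m; have bp := bphi m.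
rewrite (@le_trans _ _ (\int[P]_w (((Sum m w ^+ 4 + 8 * B ^+ 2 * Sum m w ^+ 2) +
    3 * B ^+ 4) + 4 * (Sum m w ^+ 3 * phi m w))))//.
  apply: bounded_le_Rintegral.
  - solve_bounded_measurable.
  - solve_bounded_measurable.
  - move=> w; have p2 : phi m w ^+ 2 <= B ^+ 2.
      by rewrite -(real_normK (num_real (phi m w))) ler_pXn2r// nnegrE.
    set s := Sum m w; set p := phi m w in p2 *.
    have -> : (s + p) ^+ 4 = s ^+ 4 + 6 * (s ^+ 2 * p ^+ 2) + 4 * (s * p * p ^+ 2)
      + p ^+ 2 * p ^+ 2 + 4 * (s ^+ 3 * p) by ring.
    rewrite lerD2r.
    have h1 : s ^+ 2 * p ^+ 2 <= s ^+ 2 * B ^+ 2 by rewrite ler_wpM2l// sqr_ge0.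
    have h2 : p ^+ 2 * p ^+ 2 <= B ^+ 2 * B ^+ 2 by rewrite ler_pM// sqr_ge0.
    have h3 : 4 * (s * p * p ^+ 2) <= 2 * (s ^+ 2 * p ^+ 2) + 2 * (p ^+ 2 * p ^+ 2).
      have -> : 4 * (s * p * p ^+ 2) = 2 * (2 * s * p) * p ^+ 2 by ring.
      have := sqr_ge0 (s - p); have := sqr_ge0 p; nra.
    have -> : B ^+ 4 = B ^+ 2 * B ^+ 2 by rewrite -exprD.
    lra.
rewrite !bounded_RintegralD ?bounded_RintegralZ ?Sum_phi0; last first.
all: try solve_bounded_measurable.
rewrite Rintegral_probability_cst mulr0 addr0.
have s2 := centered_second_moment m.
have : 8 * B ^+ 2 * \int[P]_w (Sum m w ^+ 2) <= 8 * m%:R * B ^+ 4.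
  have -> : 8 * m%:R * B ^+ 4 = 8 * B ^+ 2 * (m%:R * B ^+ 2) by ring.
  by rewrite ler_wpM2l// mulr_ge0// sqr_ge0.
have B4 : 0 <= B ^+ 4 by rewrite exprn_even_ge0.
rewrite -[m.+1%:R]natr1; move: ih; set I4 := \int[P]_w _; set I2 := _ * \int[P]_w _.
rewrite -[B * _]/(B ^+ 4); set b := B ^+ 4 in B4 *; set x := m%:R => h1 h2.
have -> : 4 * (x + 1) ^+ 2 * b = 4 * x ^+ 2 * b + 8 * x * b + 4 * b by ring.
lra.
Qed.

End moments.

(** * Almost sure convergence of averages *)

Section summability.
Context {R : realType}.

(* Bounds the p-series by a telescoping series. *)
Lemma powR_telescope (t : R) n : 0 < t ->
  t * n.+2%:R `^ (- (1 + t)) <= n.+1%:R `^ (- t) - n.+2%:R `^ (- t).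
Proof.
move=> t0; set x : R := n.+1%:R; set y : R := n.+2%:R.
have x0 : 0 < x by rewrite ltr0n.
have y0 : 0 < y by rewrite ltr0n.
have yx : y = x + 1 by rewrite /x natr1.
have -> : x `^ (- t) = y `^ (- t) * expR (t * (ln y - ln x)).
  rewrite /powR !gt_eqF// -expRD; congr expR; ring.
have -> : y `^ (- (1 + t)) = y `^ (- t) * y^-1.
  rewrite opprD powRD; last by rewrite (gt_eqF y0) implybT.
  by rewrite powR_inv1 ?(ltW y0)// mulrC.
have yt : 0 < y `^ (- t) by exact: powR_gt0.
(* This is ln (1 + u) <= u at u = - 1/y, since x / y = 1 - 1/y; the inequality 1 + v <= exp v then
   gives the telescoping bound. *)
have h : y^-1 <= ln y - ln x.
  have -> : ln y - ln x = - ln (x / y).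
    by rewrite ln_div ?posrE// opprB.
  have -> : x / y = 1 - y^-1.
    rewrite (_ : x = y - 1); last by rewrite yx addrK.
    by rewrite mulrBl mul1r divff// gt_eqF.
  rewrite lerNr; apply: le_ln1Dx.
  by rewrite ltrN2 invf_lt1// yx ltrDr.
have h2 := expR_ge1Dx (t * (ln y - ln x)).
have h3 : t * y^-1 <= t * (ln y - ln x) by rewrite ler_pM2l.
have : y `^ (- t) * (1 + t * y^-1) <= y `^ (- t) * expR (t * (ln y - ln x)).
  by rewrite ler_pM2l// (le_trans _ h2)// lerD2l.
by rewrite mulrDr mulr1 => h4; rewrite lerBrDl mulrCA.
Qed.

Lemma cvg_pseries (p : R) : 1 < p -> cvgn (series (fun n => n.+1%:R `^ (- p))).
Proof.
move=> p1; have t0 : 0 < p - 1 by rewrite subr_gt0.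
apply: nondecreasing_is_cvgn.
  by apply/nondecreasing_series => n _ _; exact: powR_ge0.
(* The first term is 1, and each later one is at most 1 / (p - 1) times a difference of consecutive
   powers with exponent - (p - 1). *)
have hb n : series (fun k => k.+1%:R `^ (- p)) n.+1 <=
    1 + (p - 1)^-1 * (1 - n.+1%:R `^ (- (p - 1))).
  elim: n => [|n ih].
    by rewrite /series/= big_nat1 !powR1 subrr mulr0 addr0.
  rewrite /series/= big_nat_recr//=; move: ih; rewrite /series/=.
  have := powR_telescope n t0; rewrite (_ : - (1 + (p - 1)) = - p); last by ring.
  set A := \sum_(_ <= _ < _) _; set u := n.+2%:R `^ (- p).
  set v := n.+1%:R `^ _; set v' := n.+2%:R `^ _; move=> h1 h2.
  have : u <= (p - 1)^-1 * (v - v') by rewrite ler_pdivlMl.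
  rewrite !mulrBr; lra.
exists (1 + (p - 1)^-1) => _ [[|n] _ <-].
  by rewrite /series/= big_geq// addr_ge0// invr_ge0 ltW.
rewrite (le_trans (hb n))// lerD2l mulrBr mulr1 gerBl.
by rewrite mulr_ge0 ?invr_ge0 ?powR_ge0// ltW.
Qed.

Lemma near_pseries_cvg (a : nat -> R) (C p : R) : 1 < p -> (forall n, 0 <= a n) ->
  (\forall n \near \oo, a n <= C * n.+1%:R `^ (- p)) -> cvgn (series a).
Proof.
move=> p1 a0 [N _ aN]; pose a' n := if (n < N)%N then 0 else a n.
have : cvgn (series a').
  apply: (@series_le_cvg _ _ (fun n => `|C| * n.+1%:R `^ (- p))).
  - by move=> n; rewrite /a'; case: ifP.
  - by move=> n; rewrite mulr_ge0// powR_ge0.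
  - move=> n; rewrite /a'; case: ltnP => [_|Nn].
      by rewrite mulr_ge0// powR_ge0.
    by rewrite (le_trans (aN n Nn))// ler_wpM2r ?powR_ge0// ler_norm.
  - exact: (@is_cvg_seriesZ R (fun n => n.+1%:R `^ (- p)) `|C| (cvg_pseries p1)).
rewrite -(is_cvg_series_restrict N) -[cvgn (series a)](is_cvg_series_restrict N).
suff -> : (fun n => \sum_(N <= k < n) a k) = (fun n => \sum_(N <= k < n) a' k) by [].
apply/funext => n; apply: eq_big_nat => k /andP[Nk _].
by rewrite /a' ltnNge Nk.
Qed.

Lemma expr4_add_le (x y : R) : (x + y) ^+ 4 <= 8 * (x ^+ 4 + y ^+ 4).
Proof.
have q1 : (x + y) ^+ 2 <= 2 * (x ^+ 2 + y ^+ 2).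
  have := sqr_ge0 (x - y); rewrite sqrrB sqrrD; lra.
have q2 : ((x + y) ^+ 2) ^+ 2 <= (2 * (x ^+ 2 + y ^+ 2)) ^+ 2.
  by rewrite ler_pXn2r// nnegrE ?sqr_ge0// mulr_ge0// addr_ge0 ?sqr_ge0.
rewrite -exprM in q2; apply: (le_trans q2).
have := sqr_ge0 (x ^+ 2 - y ^+ 2).
have -> : (2 * (x ^+ 2 + y ^+ 2)) ^+ 2 = 4 * (x ^+ 4 + y ^+ 4) + 8 * (x ^+ 2 * y ^+ 2) by ring.
have -> : (x ^+ 2 - y ^+ 2) ^+ 2 = x ^+ 4 + y ^+ 4 - 2 * (x ^+ 2 * y ^+ 2) by ring.
lra.
Qed.

Lemma cvg_expr4_0 (u : nat -> R) :
  (fun n => u n ^+ 4) @ \oo --> 0 -> u @ \oo --> 0.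
Proof.
move=> /cvgrPdist_lt u4; apply/cvgrPdist_lt => e e0.
have e4 : 0 < e ^+ 4 by rewrite exprn_gt0.
near=> n; have : `|0 - u n ^+ 4| < e ^+ 4 by near: n; exact: u4.
rewrite !sub0r !normrN normrX ltr_pXn2r// nnegrE//; exact: ltW.
Unshelve. all: by end_near. Qed.

End summability.

Section almost_sure_convergence.
Context {d : measure_display} {T : measurableType d} {R : realType}.
Variable P : probability T R.

(** By monotone convergence the series of the [D n] has a finite expectation, so it converges almost
    surely and its general term tends to 0. This combines Markov's inequality and the Borel-Cantelli
    lemma in one step. *)
Lemma ae_cvg0 (D : nat -> T -> R) (a : nat -> R) :
  (forall n, bounded_measurable (D n)) -> (forall n w, 0 <= D n w) ->
  (forall n, \int[P]_w D n w <= a n) -> cvgn (series a) ->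
  {ae P, forall w, D ^~ w @ \oo --> 0}.
Proof.
move=> bD D0 Da ca.
have mD n : measurable_fun setT (fun w => (D n w)%:E).
  by apply/measurable_EFinP; case: (bD n).
have a0 n : 0 <= a n by rewrite (le_trans _ (Da n))// Rintegral_ge0.
have intD : P.-integrable setT (fun w => (\sum_(n <oo) (D n w)%:E)%E).
  apply/integrableP; split.
    by apply: ge0_emeasurable_sum => // n w _ _; rewrite lee_fin.
  have -> : (\int[P]_w `|\sum_(n <oo) (D n w)%:E| =
      \int[P]_w \sum_(n <oo) (D n w)%:E)%E.
    apply: eq_integral => w _; rewrite gee0_abs//.
    by apply: nneseries_ge0 => n _ _; rewrite lee_fin.
  rewrite integral_nneseries//; last by move=> n w _; rewrite lee_fin.
  have -> : (\sum_(n <oo) \int[P]_w (D n w)%:E =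
      \sum_(n <oo) (\int[P]_w D n w)%:E)%E.
    by apply: eq_eseriesr => n _; rewrite bounded_Rintegral_EFin.
  apply: (@le_lt_trans _ _ (\sum_(n <oo) (a n)%:E)%E).
    apply: lee_nneseries => n _; first by rewrite lee_fin Rintegral_ge0.
    by rewrite lee_fin.
  apply: (@le_lt_trans _ _ (limn (series a))%:E); last exact: ltry.
  apply: lime_le; first by apply: is_cvg_nneseries => n _ _; rewrite lee_fin.
  near=> n; rewrite sumEFin lee_fin; apply: nondecreasing_cvgn_le => //.
  by apply/nondecreasing_series => k _ _.
have := integrable_ae measurableT intD; apply: filterS => w /(_ I) fw.
apply: cvg_series_cvg_0; apply: nondecreasing_is_cvgn.
  by apply/nondecreasing_series => k _ _.
exists (fine (\sum_(n <oo) (D n w)%:E)%E) => _ [n _ <-].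
rewrite -lee_fin fineK// /series/= -sumEFin.
by apply: nneseries_lim_ge => k _; rewrite lee_fin.
Unshelve. all: by end_near. Qed.

End almost_sure_convergence.

(** * Averages over pairs of observations and a strong law of large numbers *)

Section averages.
Context {d : measure_display} {T : measurableType d} {R : realType}.
Variable P : probability T R.
Context {d1 : measure_display} {S : measurableType d1}.
Variable Z : nat -> T -> S.
Hypothesis mZ : forall i, measurable_fun setT (Z i).
Hypothesis indZ : mutually_independent P Z.

(** For each [i] the diagonal term, bounded by B, is split off with (x + y)^4 <= 8 (x^4 + y^4); the
    rest has fourth moment at most 4 n^2 B^4. For n >= 1 the total is at most 8 n^-4 (1 + 4 n^2) B^4
    <= 40 n^-2 B^4. *)
Lemma centered_pair_average_fourth_moment (psi : S * S -> R) (B : R) (n : nat) :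
  measurable_fun setT psi -> (forall s, `|psi s| <= B) ->
  (forall k s, \int[P]_w psi (s, Z k w) = 0) ->
  \int[P]_w (n%:R^-1 * \sum_(i < n)
     (n%:R^-1 * \sum_(k < n) psi (Z i w, Z k w)) ^+ 4)
  <= 40 * B ^+ 4 * (n%:R ^+ 2)^-1.
Proof.
case: n => [|n] mpsi psiB psi0.
  under eq_Rintegral do rewrite big_ord0 mulr0.
  by rewrite Rintegral_probability_cst expr0n/= invr0 mulr0.
have bpsi i k : bounded_measurable (fun w => psi (Z i w, Z k w)).
  split; last by exists B.
  by apply: measurableT_comp => //; exact: measurable_fun_pair.
have B4 : 0 <= B ^+ 4 by rewrite exprn_even_ge0.
set N : R := n.+1%:R.
have N1 : 1 <= N by rewrite ler1n.
have N0 : 0 < N by exact: lt_le_trans N1.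
pose M i w := N^-1 * \sum_(k < n.+1) psi (Z i w, Z k w).
have bM i : bounded_measurable (M i).
  apply: bounded_measurableM; first exact: bounded_measurable_cst.
  exact: bounded_measurable_sum.
have bM4 i : bounded_measurable (fun w => M i w ^+ 4) by exact: bounded_measurableX.
have M4 (i : 'I_n.+1) : \int[P]_w (M i w ^+ 4) <= 40 * B ^+ 4 * (N ^+ 2)^-1.
  have m4 := centered_fourth_moment mZ indZ mpsi psiB psi0 i n.+1.
  set S4 := fun w => (\sum_(k < n.+1) (if val k == i then 0 else psi (Z i w, Z k w))) ^+ 4.
  have bS4 : bounded_measurable S4.
    apply: bounded_measurableX; apply: bounded_measurable_sum => k.
    by case: (val k == i :> nat) => //; exact: bounded_measurable_cst.
  have ptw w : M i w ^+ 4 <= N^-1 ^+ 4 * 8 * (B ^+ 4 + S4 w).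
    rewrite /M exprMn -mulrA ler_pM2l ?exprn_gt0 ?invr_gt0//.
    rewrite /S4 (bigD1 i)//= [in leRHS](bigD1 i)//= eqxx add0r.
    rewrite [in leRHS](eq_bigr (fun k => psi (Z i w, Z (val k) w))); last first.
      by move=> k ki; rewrite ifN.
    set s := \sum_(_ < _ | _) _; set p := psi _.
    have p4 : p ^+ 4 <= B ^+ 4.
      rewrite -(ger0_norm (exprn_even_ge0 p (isT : ~~ odd 4))) normrX.
      by rewrite lerXn2r ?nnegrE//; [exact: le_trans (psiB (Z i w, Z i w))|exact: psiB].
    have := expr4_add_le p s; lra.
  rewrite (@le_trans _ _ (\int[P]_w (N^-1 ^+ 4 * 8 * (B ^+ 4 + S4 w))))//.
    apply: bounded_le_Rintegral => //; apply: bounded_measurableM.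
      exact: bounded_measurable_cst.
    by apply: bounded_measurableD => //; exact: bounded_measurable_cst.
  rewrite bounded_RintegralZ; last first.
    by apply: bounded_measurableD => //; exact: bounded_measurable_cst.
  rewrite bounded_RintegralD//; last exact: bounded_measurable_cst.
  rewrite Rintegral_probability_cst.
  rewrite (@le_trans _ _ (N^-1 ^+ 4 * 8 * (B ^+ 4 + 4 * N ^+ 2 * B ^+ 4)))//.
    by rewrite ler_pM2l ?lerD2l// mulr_gt0// exprn_gt0// invr_gt0.
  have -> : 40 * B ^+ 4 * (N ^+ 2)^-1 = N^-1 ^+ 4 * 8 * (5 * N ^+ 2 * B ^+ 4).
    by field; rewrite gt_eqF.
  rewrite ler_pM2l; last by rewrite mulr_gt0// exprn_gt0// invr_gt0.
  have N2 : 1 <= N ^+ 2 by rewrite expr_ge1// (le_trans _ N1).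
  have : 1 * B ^+ 4 <= N ^+ 2 * B ^+ 4 by rewrite ler_wpM2r.
  lra.
rewrite -[leLHS]/(\int[P]_w (N^-1 * \sum_(i < n.+1) M i w ^+ 4)).
rewrite bounded_RintegralZ; last by apply: bounded_measurable_sum => i.
rewrite (bounded_Rintegral_sum P _ (fun i : 'I_n.+1 => bM4 i)) ler_pdivrMl//.
apply: (@le_trans _ _ (\sum_(i < n.+1) 40 * B ^+ 4 * (N ^+ 2)^-1)).
  by apply: ler_sum => i _; exact: M4.
by rewrite sumr_const card_ord -[leLHS]mulr_natl.
Qed.

(** The fourth moment of the centered average is O(n^-2), which is summable, so [ae_cvg0] applies to
    its fourth power. *)
Lemma bounded_SLLN (phi : S -> R) (mu : R) :
  bounded_measurable phi -> (forall k, \int[P]_w phi (Z k w) = mu) ->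
  {ae P, forall w, (fun n => n%:R^-1 * \sum_(k < n) phi (Z k w)) @ \oo --> mu}.
Proof.
move=> [mphi [M phiM]] phimu.
have bphi k : bounded_measurable (fun w => phi (Z k w)).
  by split; [exact: measurableT_comp|exists M].
pose psi (s : S * S) := phi s.2 - mu.
have mpsi : measurable_fun setT psi.
  by apply: measurable_funB => //; exact: measurableT_comp.
have psiB s : `|psi s| <= M + `|mu|.
  by rewrite (le_trans (ler_normB _ _))// lerD2r.
have psi0 k s : \int[P]_w psi (s, Z k w) = 0.
  rewrite /psi/= bounded_RintegralD//; last exact: bounded_measurable_cst.
  by rewrite phimu Rintegral_probability_cst subrr.
pose D n w := (n%:R^-1 * \sum_(k < n) (phi (Z k w) - mu)) ^+ 4.
have DE n : \int[P]_w D n w <= 4 * (M + `|mu|) ^+ 4 * (n%:R ^+ 2)^-1.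
  have := centered_fourth_moment mZ indZ mpsi psiB psi0 n n.
  rewrite (_ : (fun w => _) = fun w => (\sum_(k < n) (phi (Z k w) - mu)) ^+ 4); last first.
    apply/funext => w; congr (_ ^+ 4); apply: eq_bigr => k _.
    by rewrite (ltn_eqF (ltn_ord k)).
  move=> h; rewrite /D; under eq_Rintegral do rewrite exprMn.
  rewrite bounded_RintegralZ; last first.
    apply: bounded_measurableX; apply: bounded_measurable_sum => k.
    by apply: bounded_measurableB => //; exact: bounded_measurable_cst.
  case: n h => [|n] h; first by rewrite !mulr0n expr0n invr0 expr0n/= mul0r mulr0.
  have : (n.+1%:R : R) != 0 by rewrite pnatr_eq0.
  move: h; set x : R := n.+1%:R => h x0.
  rewrite -[leRHS](_ : x^-1 ^+ 4 * (4 * x ^+ 2 * (M + `|mu|) ^+ 4) = _).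
    by rewrite ler_pM2l// exprn_gt0// invr_gt0 ltr0n.
  by field.
have bD n : bounded_measurable (D n).
  apply: bounded_measurableX; apply: bounded_measurableM.
    exact: bounded_measurable_cst.
  apply: bounded_measurable_sum => k.
  by apply: bounded_measurableB => //; exact: bounded_measurable_cst.
have C0 : 0 <= 4 * (M + `|mu|) ^+ 4 by rewrite mulr_ge0// exprn_even_ge0.
move: (4 * _) DE C0 => C DE C0.
have cD : cvgn (series (fun n => C * (n%:R ^+ 2)^-1)).
  (* The factor 4 pays for the shift from n^-2 to (n + 1)^-2, as n + 1 <= 2 n for n >= 1. *)
  apply: (@near_pseries_cvg _ _ (C * 4) 2).
  - by rewrite ltr1n.
  - by move=> n; rewrite mulr_ge0// invr_ge0 sqr_ge0.
  - near=> n; rewrite -mulrA ler_wpM2l//.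
    have n0 : (0 < n)%N by near: n; exact: nbhs_infty_gt.
    rewrite powR_invn// ler_pdivlMr ?exprn_gt0 ?ltr0n// mulrC ler_pdivrMr ?exprn_gt0 ?ltr0n//.
    rewrite -natrX -natrX -natrM ler_nat.
    by rewrite (_ : 4 = 2 ^ 2)%N// -expnMn leq_exp2r// mul2n -addnn -addn1 leq_add2l.
have D0 n w : 0 <= D n w by exact: exprn_even_ge0.
apply: filterS (ae_cvg0 bD D0 DE cD) => w /cvg_expr4_0 Dw.
apply/subr_cvg0; apply: cvg_trans Dw; apply: near_eq_cvg; near=> n.
rewrite sumrB sumr_const card_ord mulrBr -[mu *+ n]mulr_natl mulKf// pnatr_eq0 -lt0n.
by near: n; exact: nbhs_infty_gt.
Unshelve. all: by end_near. Qed.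

End averages.

(** * Bias of kernel smoothing *)

Section taylor.
Context {R : realType}.

(** Mean value theorem between 0 and x. The gain 1 / (k + 1) of an exact integration is given up, so
    the constant [c] stays the same when the lemma is iterated. *)
Lemma primitive_bound (phi dphi : R -> R) (c e : R) (k : nat) : 0 <= c ->
  (forall x : R, is_derive x 1 phi (dphi x)) -> phi 0 = 0 ->
  (forall x, `|x| < e -> `|dphi x| <= c * `|x| ^+ k) ->
  forall x, `|x| < e -> `|phi x| <= c * `|x| ^+ k.+1.
Proof.
move=> c0 hd p0 hb x xe.
have cphi : continuous phi.
  by move=> z; apply/differentiable_continuous/derivable1_diffP; case: (hd z).
have bound z : `|z| <= `|x| -> `|dphi z * x| <= c * `|x| ^+ k.+1.
  move=> zx; rewrite normrM exprSr mulrA ler_wpM2r//.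
  rewrite (le_trans (hb z (le_lt_trans zx xe)))// ler_wpM2l//.
  by rewrite lerXn2r// nnegrE.
have [x0|x0|->] := ltgtP x 0; last by rewrite p0 normr0 expr0n mulr0.
- have [z zx E] := MVT x0 (fun z _ => hd z) (continuous_subspaceT cphi).
  move: E; rewrite p0 !sub0r mulrN => /oppr_inj ->; apply: bound.
  move: zx; rewrite in_itv/= => /andP[xz z0].
  by rewrite !ltr0_norm// lerN2 ltW.
- have [z zx E] := MVT x0 (fun z _ => hd z) (continuous_subspaceT cphi).
  move: E; rewrite p0 !subr0 => ->; apply: bound.
  move: zx; rewrite in_itv/= => /andP[z0 zx].
  by rewrite !gtr0_norm// ltW.
Qed.

Lemma is_derive_shift (f : R -> R) (y u : R) : derivable f (y + u) 1 ->
  is_derive u 1 (fun x => f (y + x)) (derive1 f (y + u)).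
Proof.
move=> df; have df' : is_derive (y + u) 1 f (derive1 f (y + u)).
  by rewrite derive1E; exact: DeriveDef.
have dy : is_derive u 1 (fun x : R => y + x) 1.
  by apply: is_derive_eq; rewrite add0r mulr1.
by have := is_derive1_comp df' dy; rewrite mulr1.
Qed.

(** The remainders [r0], [r1], [r2] of f, f', f'' vanish at u = 0, and each is a primitive of the
    next. Starting from the Lipschitz bound on the third derivative, [primitive_bound] is applied
    three times and raises the power of |u| from 1 to 4. *)
Lemma taylor3_bound (f : R -> R) (c e : R) : 0 <= c -> times_derivable 3 f ->
  (forall u y, `|u| < e -> `|derive1n 3 f (y + u) - derive1n 3 f y| <= c * `|u|) ->
  forall y u, `|u| < e ->
  `|f (y + u) - (f y + u * derive1n 1 f y + u ^+ 2 * (derive1n 2 f y / 2)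
     + u ^+ 3 * (derive1n 3 f y / 6))| <= c * `|u| ^+ 4.
Proof.
move=> c0 df lip y.
have d k x : (k < 3)%N ->
    is_derive x (1 : R) (fun u => derive1n k f (y + u)) (derive1n k.+1 f (y + x)).
  by move=> k3; apply: is_derive_shift; exact: df.
set f1 := derive1n 1 f y; set f2 := derive1n 2 f y; set f3 := derive1n 3 f y.
pose r2 u := derive1n 2 f (y + u) - (f2 + u * f3).
pose r1 u := derive1n 1 f (y + u) - (f1 + u * f2 + u ^+ 2 * (f3 / 2)).
pose r0 u := f (y + u) - (f y + u * f1 + u ^+ 2 * (f2 / 2) + u ^+ 3 * (f3 / 6)).
have h2 u : `|u| < e -> `|r2 u| <= c * `|u| ^+ 2.
  apply: (@primitive_bound _ (fun u => derive1n 3 f (y + u) - f3)) => //.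
  - move=> x; have := d 2 x isT => ?.
    by apply: is_derive_eq; rewrite /GRing.scale/=; ring.
  - by rewrite /r2 mul0r !addr0 subrr.
  - by move=> x xe; rewrite expr1; exact: lip.
have h1 u : `|u| < e -> `|r1 u| <= c * `|u| ^+ 3.
  apply: (@primitive_bound _ r2) => //.
  - move=> x; have := d 1 x isT => ?.
    by apply: is_derive_eq; rewrite /r2 /GRing.scale/=; field.
  - by rewrite /r1 expr0n /= !mul0r !addr0 subrr.
move=> u; rewrite -/(r0 u); move: u; apply: (@primitive_bound _ r1) => //.
- move=> x; have := d 0 x isT => ?.
  by apply: is_derive_eq; rewrite /r1 /GRing.scale/=; field.
- by rewrite /r0 !expr0n /= !mul0r !addr0 subrr.
Qed.

End taylor.

Section kernel_bias.
Context {R : realType}.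
Notation mu := (@lebesgue_measure R).
Variables (K : R -> R) (M : R).
Hypothesis contK : continuous K.
Hypothesis suppK : support_of K = [set u | -1 <= u <= 1].
Hypothesis boundK : forall u, `|K u| <= M.

Lemma kernel_eq0 u : ~~ (-1 <= u <= 1) -> K u = 0.
Proof.
move=> u1; apply/eqP; apply: contraNT u1 => Ku.
have : support_of K u by apply: subset_closure.
by rewrite suppK.
Qed.

Lemma kernel_Rintegral (F : R -> R) :
  (forall u, ~~ (-1 <= u <= 1) -> F u = 0) ->
  \int[mu]_u F u = \int[mu]_(u in `[-1, 1]) F u.
Proof.
move=> F0; rewrite [RHS]Rintegral_mkcond; congr (Rintegral _ _ _).
apply/funext => u; rewrite patchE mem_setE in_itv/=.
by case: ifPn => // /F0.
Qed.

(** The orientation-reversing substitution x = y - h u. It is carried out on a compact interval,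
    because the integrand on the left vanishes outside [y - h, y + h]. *)
Lemma kernel_substitution (f : R -> R) (h y : R) : 0 < h -> continuous f ->
  \int[mu]_x (h^-1 * K ((y - x) / h) * f x) =
  \int[mu]_(u in `[-1, 1]) (K u * f (y - h * u)).
Proof.
move=> h0 cf; pose G x := h^-1 * K ((y - x) / h) * f x.
pose F u := y - h * u.
have dF u : is_derive u (1 : R) F (- h).
  by apply: is_derive_eq; rewrite /GRing.scale/=; ring.
have F' : derive1 F = cst (- h).
  by apply/funext => u; rewrite derive1E; apply: derive_val.
have cF : continuous F.
  by move=> u; apply/differentiable_continuous/derivable1_diffP; case: (dF u).
have cG : continuous G.
  move=> x; apply: cvgM; last exact: cf.
  apply: cvgM; first exact: cvg_cst.
  apply: (@continuous_comp _ _ _ (fun x => (y - x) / h) K); last exact: contK.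
  apply: cvgM; last exact: cvg_cst.
  by apply: cvgB; [exact: cvg_cst|exact: cvg_id].
(* The endpoints are F 1 = y - h and F (-1) = y + h, since [F] is decreasing. *)
transitivity (\int[mu]_(x in `[F 1, F (-1)]) G x).
  rewrite [RHS]Rintegral_mkcond; congr (Rintegral _ _ _).
  apply/funext => x; rewrite patchE mem_setE in_itv/= /F mulr1 mulrN1 opprK.
  case: ifPn => // xh; rewrite kernel_eq0 ?mulr0 ?mul0r//.
  apply: contra xh; rewrite ler_pdivlMr// ler_pdivrMr// mul1r mulN1r.
  by move=> /andP[h1 h2]; apply/andP; split; lra.
rewrite /Rintegral; congr fine.
rewrite integration_by_substitution_decreasing//.
- apply: eq_integral => u _; rewrite F'/= /G /F /= fctE/=; congr EFin.
  by rewrite opprK (_ : (y - (y - h * u)) / h = u); field; rewrite gt_eqF.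
- by move=> u v _ _ uv; rewrite /F; nra.
- by move=> u _; rewrite F'; exact: cvg_cst.
- by rewrite F'; exact: is_cvg_cst.
- by rewrite F'; exact: is_cvg_cst.
- split; first by move=> u _; case: (dF u).
  + exact/cvg_at_right_filter/cF.
  + exact/cvg_at_left_filter/cF.
- exact: continuous_subspaceT.
Qed.

Hypothesis intK : \int[mu]_u K u = 1.
Hypothesis momentK : forall k, (1 <= k <= 3)%N -> \int[mu]_u (u ^+ k * K u) = 0.

(** Expand f (y - h u) to third order: the constant term integrates to f y, the moments of [K]
    remove the next three, and the remainder is at most c h^4 times |K u| <= M. The factor 2 is the
    length of [-1, 1]. *)
Lemma kernel_bias (f : R -> R) (c e h y : R) : 0 <= c -> times_derivable 3 f ->
  (forall u y, `|u| < e -> `|derive1n 3 f (y + u) - derive1n 3 f y| <= c * `|u|) ->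
  0 < h -> h < e ->
  `|\int[mu]_x (h^-1 * K ((y - x) / h) * f x) - f y| <= 2 * M * c * h ^+ 4.
Proof.
move=> c0 df lip h0 he.
have cf : continuous f.
  by move=> x; apply/differentiable_continuous/derivable1_diffP; exact: (df 0).
rewrite kernel_substitution//.
set f1 := derive1n 1 f y; set f2 := derive1n 2 f y; set f3 := derive1n 3 f y.
pose I (F : R -> R) := \int[mu]_(u in `[-1, 1]) F u.
have icont (F : R -> R) : continuous F -> mu.-integrable `[-1, 1] (EFin \o F).
  by move=> cF; apply: continuous_compact_integrable; [exact: segment_compact|exact: continuous_subspaceT].
have cX k : continuous (fun u : R => u ^+ k) by exact: exprn_continuous.
have cXK k : continuous (fun u : R => u ^+ k * K u).
  by move=> u; apply: cvgM; [exact: cX|exact: contK].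
have cZ a (F : R -> R) : continuous F -> continuous (fun u : R => a * F u).
  by move=> cF u; apply: cvgM; [exact: cvg_cst|exact: cF].
have cD (F G : R -> R) : continuous F -> continuous G -> continuous (fun u : R => F u + G u).
  by move=> cF cG u; apply: cvgD; [exact: cF|exact: cG].
have iXK k a : mu.-integrable `[-1, 1] (EFin \o (fun u => a * (u ^+ k * K u))).
  exact/icont/cZ.
have moment k a : \int[mu]_(u in `[-1, 1]) (a * (u ^+ k * K u)) =
    a * \int[mu]_u (u ^+ k * K u).
  rewrite RintegralZl//; last exact: icont.
  by rewrite -kernel_Rintegral// => u /kernel_eq0 ->; rewrite mulr0.
(* [T] is K u times the Taylor polynomial of f at increment - h u, arranged by moments; [u ^+ 0]
   gives the constant term the same shape as the others. *)
pose T (u : R) := f y * (u ^+ 0 * K u) + - h * f1 * (u ^+ 1 * K u) +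
  h ^+ 2 * (f2 / 2) * (u ^+ 2 * K u) + - h ^+ 3 * (f3 / 6) * (u ^+ 3 * K u).
have cT : continuous T by do 3 (apply: (cD); last exact: cZ); exact: cZ.
have IT : I T = f y.
  rewrite /I /T RintegralD//; last by apply: icont; do 2 (apply: (cD); last exact: cZ); exact: cZ.
  rewrite RintegralD//; last by apply: icont; do 1 (apply: (cD); last exact: cZ); exact: cZ.
  rewrite RintegralD// !moment (@momentK 1)// (@momentK 2)// (@momentK 3)// !mulr0 !addr0.
  under eq_Rintegral do rewrite expr0 mul1r.
  by rewrite intK mulr1.
have cKf : continuous (fun u : R => K u * f (y - h * u)).
  move=> u; apply: cvgM; first exact: contK.
  apply: (@continuous_comp _ _ _ (fun u : R => y - h * u) f); last exact: cf.
  by apply: cvgB; [exact: cvg_cst|apply: cvgM; [exact: cvg_cst|exact: cvg_id]].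
rewrite -IT /I -RintegralB//; [|exact: icont|exact: icont].
have cB : continuous (fun u : R => K u * f (y - h * u) - T u).
  by move=> u; apply: cvgB; [exact: cKf|exact: cT].
apply: (le_trans (le_normr_Rintegral _ _)) => //; first exact: icont.
have -> : 2 * M * c * h ^+ 4 = \int[mu]_(u in `[-1, 1]) (M * c * h ^+ 4).
  have mu2 : fine (mu `[(-1), 1]%classic) = 2.
    by rewrite lebesgue_measure_itv/= lte_fin ifT; [rewrite /=; lra|lra].
  by rewrite Rintegral_cst// [fine _]mu2; ring.
apply: le_Rintegral => //.
- exact: integrable_norm (icont _ cB).
- by apply: icont => u; exact: cvg_cst.
- move=> u /=; rewrite in_itv/= => u1.
  have u1' : `|u| <= 1 by rewrite ler_norml.
  have hu : `|- (h * u)| <= h by rewrite normrN normrM gtr0_norm// ler_piMr// ltW.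
  have := taylor3_bound c0 df lip y (le_lt_trans hu he).
  rewrite -/f1 -/f2 -/f3 => tb.
  have -> : K u * f (y - h * u) - T u = K u * (f (y - h * u) - (f y + - (h * u) * f1 +
      (- (h * u)) ^+ 2 * (f2 / 2) + (- (h * u)) ^+ 3 * (f3 / 6))).
    by rewrite /T; ring.
  rewrite normrM -mulrA ler_pM//; apply: (le_trans tb).
  by rewrite ler_wpM2l// lerXn2r// nnegrE ltW.
Qed.

End kernel_bias.

(** * Densities and conditional expectation *)

(** Products of two exhaustions by sets of finite measure. Taking both nondecreasing lets one index
    serve both factors: a point covered at stages n and k lies in the product at stage max n k. *)
Lemma product_measure_sigma_finite {d1 d2 : measure_display}
    {S1 : measurableType d1} {S2 : measurableType d2} {R : realType}
    (m1 : {sigma_finite_measure set S1 -> \bar R})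
    (m2 : {sigma_finite_measure set S2 -> \bar R}) :
  sigma_finite setT (m1 \x m2)%E.
Proof.
have /sigma_finiteP[F [UF ndF Foo]] := sigma_finiteT m1.
have /sigma_finiteP[G [UG ndG Goo]] := sigma_finiteT m2.
exists (fun n => F n `*` G n).
  apply/seteqP; split=> // -[x y] _.
  have : (\bigcup_i F i) x by rewrite -UF.
  have : (\bigcup_i G i) y by rewrite -UG.
  move=> [k _ Gky] [n _ Fnx]; exists (maxn n k) => //; split.
    exact: (subsetPset _ _ (ndF _ _ (leq_maxl n k))).
  exact: (subsetPset _ _ (ndG _ _ (leq_maxr n k))).
move=> n; have [mF mFoo] := Foo n; have [mG mGoo] := Goo n; split.
  exact: measurableX.
by rewrite product_measure1E// lte_mul_pinfty// ge0_fin_numE.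
Qed.

(* The library's canonical sigma-finite structure on [m1 \x m2] only covers
   sub-probabilities, hence this alias of the planar Lebesgue measure. *)
Definition plane_lebesgue_measure (R : realType) :
    set (measurableTypeR R * measurableTypeR R) -> \bar R :=
  (@lebesgue_measure R \x @lebesgue_measure R)%E.

HB.instance Definition _ (R : realType) := Measure.on (@plane_lebesgue_measure R).

HB.instance Definition _ (R : realType) :=
  Measure_isSigmaFinite.Build _ _ _ (@plane_lebesgue_measure R)
    (product_measure_sigma_finite (@lebesgue_measure R) (@lebesgue_measure R)).

Section density.
Context {d : measure_display} {T : measurableType d} {R : realType}.
Variable P : probability T R.
Context {d1 : measure_display} {S : measurableType d1}.
Variable mu : {sigma_finite_measure set S -> \bar R}.
Variables (Z : T -> S) (f : S -> R).
Hypothesis mZ : measurable_fun setT Z.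
Hypothesis fdens : density_of P mu Z f.

(* The density agrees a.e. with the Radon-Nikodym derivative of the law. *)
Lemma density_ge0_integral (phi : S -> \bar R) :
  measurable_fun setT phi -> (forall s, 0 <= phi s)%E ->
  (\int[P]_w phi (Z w) = \int[mu]_s (phi s * (f s)%:E))%E.
Proof.
move=> mphi phi0; case: fdens => mf f0 fE.
pose Z' : {mfun T >-> S} := HB.pack Z (isMeasurableFun.Build _ _ _ _ Z mZ).
pose nu : {finite_measure set S -> \bar R} := distribution P Z'.
have numu : null_dominates mu nu.
  apply/null_content_dominatesP => A mA muA0; rewrite /nu /= /distribution.
  by rewrite /pushforward fE// null_set_integral//; exact/measurable_EFinP/measurable_funTS.
have mfE : measurable_fun setT (EFin \o f) by exact/measurable_EFinP.
pose RN := Radon_Nikodym_SigmaFinite.f nu mu.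
have RNf : ae_eq mu setT RN (EFin \o f).
  apply: integral_ae_eq => //.
  - exact: Radon_Nikodym_SigmaFinite.f_integrable.
  - move=> E _ mE; rewrite -Radon_Nikodym_SigmaFinite.f_integral//.
    exact: fE.
rewrite -(@ge0_integral_distribution _ _ _ _ _ P Z')//.
rewrite -(Radon_Nikodym_SigmaFinite.change_of_variables numu phi0)//.
have mRN : measurable_fun setT RN.
  exact: measurable_int (Radon_Nikodym_SigmaFinite.f_integrable numu).
apply: ae_eq_integral => //; first exact: emeasurable_funM.
  exact: emeasurable_funM.
by apply: filterS RNf => s h _; have := h I; rewrite /RN /= => ->.
Qed.

Lemma density_integrable (phi : S -> R) : measurable_fun setT phi ->
  P.-integrable setT (EFin \o (phi \o Z)) ->
  mu.-integrable setT (EFin \o (fun s => phi s * f s)).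
Proof.
move=> mphi /integrableP[_ iphi]; case: (fdens) => mf f0 fE.
apply/integrableP; split; first exact/measurable_EFinP/measurable_funM.
rewrite (_ : (\int[mu]_s _)%E = (\int[mu]_s (`|phi s|%:E * (f s)%:E))%E).
  rewrite -(@density_ge0_integral (fun s => `|phi s|%:E)) //.
  by apply/measurable_EFinP; exact: measurableT_comp.
by apply: eq_integral => s _ /=; rewrite normrM (ger0_norm (f0 s)).
Qed.

Lemma density_integral (phi : S -> R) : measurable_fun setT phi ->
  P.-integrable setT (EFin \o (phi \o Z)) ->
  (\int[P]_w (phi (Z w))%:E = \int[mu]_s (phi s * f s)%:E)%E.
Proof.
move=> mphi iphi; have imu := density_integrable mphi iphi.
case: (fdens) => mf f0 fE.
rewrite [LHS]integralE [RHS]integralE.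
have -> : (fun s => (phi s * f s)%:E)^\+%E = (fun s => (EFin \o phi)^\+ s * (f s)%:E)%E.
  apply/funext => s; rewrite !funeposE/= -[0%E]/(0%:E) -!EFin_max -EFinM.
  by rewrite maxr_pMl// mul0r.
have -> : (fun s => (phi s * f s)%:E)^\-%E = (fun s => (EFin \o phi)^\- s * (f s)%:E)%E.
  apply/funext => s; rewrite !funenegE/= -[0%E]/(0%:E) -!EFin_max -EFinM.
  by rewrite maxr_pMl// mul0r mulNr.
rewrite -!density_ge0_integral//.
- by congr (_ - _)%E; apply: eq_integral => w _; rewrite ?funeposE ?funenegE.
- by apply: measurable_funeneg; exact/measurable_EFinP.
- by apply: measurable_funepos; exact/measurable_EFinP.
Qed.

End density.

Section almost_everywhere_bounded.
Context {d : measure_display} {T : measurableType d} {R : realType}.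
Variable P : probability T R.

Lemma ae_bounded_integrable (V : T -> R) (G : R) : measurable_fun setT V ->
  {ae P, forall w, `|V w| <= G} -> P.-integrable setT (EFin \o V).
Proof.
move=> mV VG; apply/integrableP; split; first exact/measurable_EFinP.
apply: (@le_lt_trans _ _ (\int[P]_w (cst `|G|%:E w))%E).
  apply: ae_ge0_le_integral => //.
  - by apply: measurableT_comp => //; exact/measurable_EFinP.
  - by move=> w _; rewrite lee_fin.
  - apply: filterS VG => w VGw _ /=; rewrite lee_fin.
    by rewrite (le_trans VGw)// ler_norm.
rewrite integral_cst//; have /= -> := probability_setT P.
by rewrite mule1 ltry.
Qed.

End almost_everywhere_bounded.

(** * Versions of the conditional expectation given Y *)

Section conditional_expectation.
Context {d : measure_display} {T : measurableType d} {R : realType}.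
Variable P : probability T R.
Notation lambda := (@lebesgue_measure R).
(* [lebesgue_measure] lives on [measurableTypeR R], whose measurable sets are those
   of [R] but whose display is different. *)
Local Notation BR := (measurableTypeR R).
Variables (V Y : T -> R) (G : R).
Hypothesis mV : measurable_fun setT V.
Hypothesis mY : measurable_fun setT Y.
Hypothesis VG : {ae P, forall w, `|V w| <= G}.

(** Under the law of [Y] the two versions have the same integral over every Borel set, so they agree
    almost everywhere; the exceptional set is pulled back by [Y]. This links the version chosen by
    [condexp] to the explicit quotient of densities. *)
Lemma is_condexp_unique m m' : is_condexp P V Y m -> is_condexp P V Y m' ->
  {ae P, forall w, m (Y w) = m' (Y w)}.
Proof.
move=> [mm im Em] [mm' im' Em'].
pose Y' : {mfun T >-> R} := HB.pack Y (isMeasurableFun.Build _ _ _ _ Y mY).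
have : ae_eq (distribution P Y') setT (EFin \o m) (EFin \o m').
  apply: integral_ae_eq => //.
  - apply: integrable_pushforward => //; exact/measurable_EFinP.
  - exact/measurable_EFinP.
  - move=> E _ mE.
    rewrite !integral_pushforward//=; last 4 first.
    all: try exact/measurable_EFinP.
    all: try by apply: integrableS im => //; rewrite -[X in measurable X]setTI; exact: mY.
    all: try by apply: integrableS im' => //; rewrite -[X in measurable X]setTI; exact: mY.
    by rewrite Em// Em'.
move=> [N [mN N0 subN]]; exists (Y @^-1` N); split => //.
  by rewrite -[X in measurable X]setTI; exact: mY.
move=> w /= h; apply: subN => /= h'; apply: h.
by case: (h' I).
Qed.

(** For a sign s, let D be the event G < s m(Y). The integral of s (m(Y) - V) over D is 0 while the
    integrand is almost surely nonnegative there, so m(Y) = V almost surely on D; but s V <= G, so D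
    is null. The signs 1 and -1 give the two sides of the bound. *)
Lemma is_condexp_bounded m : is_condexp P V Y m ->
  {ae P, forall w, `|m (Y w)| <= G}.
Proof.
move=> [mm im Em].
have iV := ae_bounded_integrable mV VG.
have mYB B : measurable B -> measurable (Y @^-1` B).
  by move=> mB; rewrite -[X in measurable X]setTI; exact: mY.
have imS B : measurable B -> P.-integrable (Y @^-1` B) (EFin \o (m \o Y)).
  by move=> mB; apply: integrableS im => //; exact: mYB.
have iVS B : measurable B -> P.-integrable (Y @^-1` B) (EFin \o V).
  by move=> mB; apply: integrableS iV => //; exact: mYB.
have key (s : R) : s = 1 \/ s = -1 -> {ae P, forall w, s * m (Y w) <= G}.
  move=> s1; pose B := [set y | G < s * m y].
  have mB : measurable B.
    rewrite -[B]setTI; apply: measurable_fun_ltr => //.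
    exact: measurable_funM.
  pose D := Y @^-1` B.
  have mD : measurable D by exact: mYB.
  have mh : measurable_fun setT (fun w => (s * m (Y w) - s * V w)).
    apply: measurable_funB; apply: measurable_funM => //.
    exact: measurableT_comp.
  have E0 : (\int[P]_(w in D) (s * m (Y w) - s * V w)%:E = 0)%E.
    under eq_integral do rewrite -mulrBr EFinM.
    rewrite integralZl//; last first.
      rewrite (_ : (fun _ => _) = (EFin \o (m \o Y)) \- (EFin \o V))%E//.
      by apply: integrableB => //; [exact: imS|exact: iVS].
    rewrite (_ : (\int[P]_(w in D) _)%E = (\int[P]_(w in D) (((EFin \o (m \o Y)) \- (EFin \o V)) w))%E)//.
    rewrite integralB//; [|exact: imS|exact: iVS].
    rewrite (Em B mB) subee ?mule0//.
    by apply: integrable_fin_num => //; exact: iVS.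
  have : ae_eq P D (fun w => (s * m (Y w) - s * V w)%:E) (cst 0%E).
    apply/ae_eq_integral_abs => //.
      exact/measurable_EFinP/measurable_funTS.
    rewrite -[RHS]E0; apply: ae_eq_integral => //.
    - by apply: measurableT_comp => //; exact/measurable_EFinP/measurable_funTS.
    - exact/measurable_EFinP/measurable_funTS.
    - apply: filterS VG => w VGw /= Dw; rewrite ger0_norm// subr_ge0.
      apply: (le_trans _ (ltW Dw)); apply: (le_trans (ler_norm _)).
      by case: s1 => ->; rewrite ?mul1r ?mulN1r ?normrN.
  apply: filterS2 VG => w VGw /= hw; rewrite leNgt; apply/negP => Dw.
  have := hw Dw => -[] /eqP; rewrite subr_eq0 => /eqP E.
  move: Dw; rewrite E ltNge => /negP; apply.
  apply: (le_trans (ler_norm _)).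
  by case: s1 => ->; rewrite ?mul1r ?mulN1r ?normrN.
have k1 := key 1 (or_introl erefl); have k2 := key (-1) (or_intror erefl).
apply: filterS2 k1 k2 => w; rewrite mul1r mulN1r => h1 h2.
by rewrite ler_norml h1 lerNl h2.
Qed.

Variables (fVY : R * R -> R).
Hypothesis fVYdens : density_of P (lambda \x lambda)%E (fun w => (V w, Y w)) fVY.
Local Notation g := (gfun fVY).
Hypothesis mg : measurable_fun setT g.

(** Fubini for z phi(y) times the density of (V, Y): integrating over z first produces phi(y) g(y),
    and the almost sure bound on [V] provides integrability in the plane. *)
Lemma gfun_integral (phi : R -> R) : bounded_measurable phi ->
  lambda.-integrable setT (EFin \o (fun y => phi y * g y)) /\
  (\int[P]_w (V w * phi (Y w))%:E = \int[lambda]_y (phi y * g y)%:E)%E.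
Proof.
move=> [mphi [M phiM]].
have pdens : density_of P (@plane_lebesgue_measure R) (fun w => (V w, Y w)) fVY.
  exact: fVYdens.
have mVY : @measurable_fun _ _ T (BR * BR)%type setT (fun w => (V w, Y w)).
  by apply: measurable_fun_pair; [exact: mV|exact: mY].
have sect (psi : R -> R) N : measurable_fun setT psi -> (forall y, `|psi y| <= N) ->
    [/\ @measurable_fun _ _ (BR * BR)%type R setT (fun p => p.1 * psi p.2),
    P.-integrable setT (EFin \o ((fun p : R * R => p.1 * psi p.2) \o (fun w => (V w, Y w)))) &
    (lambda \x lambda)%E.-integrable setT
      (EFin \o (fun p : R * R => p.1 * psi p.2 * fVY p))].
  move=> mpsi psiN.
  have mF : @measurable_fun _ _ (BR * BR)%type R setT (fun p => p.1 * psi p.2).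
    apply: measurable_funM; first exact: measurable_fst.
    by apply: (@measurableT_comp _ _ _ _ BR) => //; exact: measurable_snd.
  have iF : P.-integrable setT (EFin \o ((fun p : R * R => p.1 * psi p.2) \o (fun w => (V w, Y w)))).
    apply: (@ae_bounded_integrable _ _ _ _ _ (G * N)).
      by apply: measurable_funM => //; exact: measurableT_comp.
    by apply: filterS VG => w VGw /=; rewrite normrM ler_pM.
  split => //.
  exact: (density_integrable mVY pdens mF iF).
have [mF iF iphi] := sect phi M mphi phiM.
have n1 (y : R) : `|1 : R| <= 1 by rewrite normr1.
(* The case [psi = 1] yields, for almost every y, the integrability of z -> z f(z, y) itself. The
   bound with [phi] would say nothing where phi(y) = 0, and it is needed to take phi(y) out of the
   inner integral. *)
have [_ _ i1] := sect (fun=> 1) 1 (measurable_cst _) n1.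
have inner : ae_eq lambda setT (fubini_G lambda (EFin \o (fun p : R * R => p.1 * phi p.2 * fVY p)))
    (EFin \o (fun y => phi y * g y)).
  have := ae_integrable2 i1; apply: filterS => y /= iy _.
  have iy' : lambda.-integrable setT (EFin \o (fun z => z * fVY (z, y))).
    by apply: eq_integrable iy => // z _ /=; rewrite mulr1.
  rewrite /fubini_G /gfun/= EFinM /Rintegral fineK; last exact: integrable_fin_num.
  rewrite -integralZl//; apply: eq_integral => z _.
  by rewrite -EFinM mulrCA mulrA.
have mgphi : measurable_fun setT (EFin \o (fun y => phi y * g y)).
  exact/measurable_EFinP/measurable_funM.
set FF := EFin \o _ in iphi inner.
have mFF : measurable_fun setT FF := measurable_int _ iphi.
have mGG := measurable_fubini_G iphi.
have iG : lambda.-integrable setT (fubini_G lambda FF).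
  apply/integrableP; split => //.
  apply: le_lt_trans ((integrable21ltyP lambda lambda mFF).1 iphi).
  apply: ge0_le_integral => //.
  - exact: measurableT_comp.
  - apply: (measurable_fun_fubini_tonelli_G (m1 := lambda) (abse \o FF)); last by move=> p; exact: abse_ge0.
    exact: measurableT_comp.
  - move=> y _; apply: le_abse_integral => //.
    by apply: measurableT_comp => //; exact: measurable_pair2.
split.
  apply/integrableP; split => //.
  case/integrableP: iG => mG; congr (_ < _)%E; apply: ae_eq_integral => //.
  - exact: measurableT_comp.
  - exact: measurableT_comp.
  - by apply: filterS inner => y h _; congr abse; exact: h.
rewrite (density_integral mVY pdens mF iF).
rewrite -(integral21_prod_meas1 iphi); apply: ae_eq_integral => //.
Qed.

Variable f : R -> R.
Hypothesis fdens : density_of P lambda Y f.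
Hypothesis fpos : forall y, 0 < f y.

(** Integrating against the law of [Y] multiplies by f, which cancels the denominator; what remains
    is the integral of g over B, equal to that of [V] over {Y in B} by [gfun_integral] at the
    indicator of B. *)
Lemma is_condexp_gfun : is_condexp P V Y (fun y => g y / f y).
Proof.
have [mf _ _] := fdens.
have mY' : @measurable_fun _ _ T BR setT Y by exact: mY.
have mgf : measurable_fun setT (fun y => g y / f y).
  apply: measurable_funM => //.
  (* Positivity of f turns the inverse into a real power, whose measurability is available. *)
  rewrite (_ : (fun y => _) = (fun y => f y `^ (-1))).
    by apply: (measurableT_comp (measurable_powR _)).
  by apply/funext => y; rewrite powR_inv1// ltW.
have [ig _] := gfun_integral (bounded_measurable_cst 1).
have igY : P.-integrable setT (EFin \o ((fun y => g y / f y) \o Y)).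
  apply/integrableP; split; first exact/measurable_EFinP/measurableT_comp.
  have mabs : @measurable_fun _ _ BR _ setT (fun y => `|g y / f y|%:E).
    by apply/measurable_EFinP; exact: measurableT_comp.
  have abs0 y : (0 <= (`|g y / f y|%R)%:E)%E by rewrite lee_fin.
  have -> : (\int[P]_w `|(EFin \o ((fun y => (g y / f y)%R) \o Y)) w| =
      \int[lambda]_y ((`|g y / f y|%R)%:E * (f y)%:E))%E.
    exact: (density_ge0_integral mY' fdens mabs abs0).
  case/integrableP: ig => _; congr (_ < _)%E; apply: eq_integral => y _ /=.
  by rewrite mul1r -EFinM normrM normfV (gtr0_norm (fpos y)) divfK// gt_eqF.
split => // B mB.
have mYB : measurable (Y @^-1` B) by rewrite -[X in measurable X]setTI; exact: mY.
have memY w : (w \in Y @^-1` B) = (Y w \in B) by apply/idP/idP; rewrite !inE.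
have b1 : bounded_measurable (\1_B : R -> R).
  split; first exact: measurable_indic.
  by exists 1 => y; rewrite indicE; case: (_ \in _); rewrite ?normr1 ?normr0.
have [_ E2] := gfun_integral b1.
transitivity (\int[lambda]_y (\1_B y * g y)%:E)%E; last first.
  rewrite -E2 [RHS]integral_mkcond; apply: eq_integral => w _.
  rewrite patchE indicE memY; case: (_ \in B); rewrite ?mulr1 ?mulr0//.
have mB1 : measurable_fun setT (fun y => \1_B y * (g y / f y)).
  exact: measurable_funM.
rewrite integral_mkcond.
transitivity (\int[P]_w ((fun y => \1_B y * (g y / f y)) (Y w))%:E)%E.
  apply: eq_integral => w _.
  by rewrite patchE indicE memY; case: (_ \in B); rewrite ?mul1r ?mul0r.
rewrite (density_integral mY' fdens mB1); last first.
  apply: le_integrable igY => //; first exact/measurable_EFinP/measurableT_comp.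
  move=> w _ /=; rewrite lee_fin normrM indicE.
  by case: (_ \in _); rewrite ?normr1 ?normr0 ?mul1r ?mul0r.
by apply: eq_integral => y _; rewrite -mulrA divfK// gt_eqF.
Qed.

End conditional_expectation.

Section covariance.
Context {d : measure_display} {T : measurableType d} {R : realType}.
Variable P : probability T R.
Variables (Y : T -> R) (G : R).
Hypothesis mY : measurable_fun setT Y.

Lemma condexpP (V : T -> R) m : is_condexp P V Y m -> is_condexp P V Y (condexp P V Y).
Proof. by move=> Vm; apply: (@xgetPex _ _ [set m | is_condexp P V Y m]); exists m. Qed.

Lemma expectation_condexp (V : T -> R) m : is_condexp P V Y m ->
  ('E_P[V] = 0)%E -> ('E_P[(fun w => m (Y w))] = 0)%E.
Proof.
move=> [_ _ /(_ setT measurableT)]; rewrite preimage_setT => E <-.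
by rewrite unlock.
Qed.

(** Centered variables have centered conditional expectations, so the covariance is the mean of the
    product. The known versions [m1], [m2] replace the chosen ones, and the clips, which act
    trivially almost surely, make the integrand bounded everywhere so that [bounded_SLLN] can reach
    this value. *)
Lemma covariance_condexp (V1 V2 : T -> R) (m1 m2 : R -> R) :
  measurable_fun setT V1 -> measurable_fun setT V2 ->
  {ae P, forall w, `|V1 w| <= G} -> {ae P, forall w, `|V2 w| <= G} ->
  ('E_P[V1] = 0)%E -> ('E_P[V2] = 0)%E ->
  is_condexp P V1 Y m1 -> is_condexp P V2 Y m2 ->
  fine (covariance P (fun w => condexp P V1 Y (Y w)) (fun w => condexp P V2 Y (Y w))) =
  \int[P]_w (clip G (m1 (Y w)) * clip G (m2 (Y w))).
Proof.
move=> mV1 mV2 VG1 VG2 E1 E2 c1 c2.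
have c1' := condexpP c1; have c2' := condexpP c2.
have a1 := is_condexp_unique mY c1' c1; have a2 := is_condexp_unique mY c2' c2.
have b1 := is_condexp_bounded mV1 mY VG1 c1; have b2 := is_condexp_bounded mV2 mY VG2 c2.
rewrite covariance.unlock (expectation_condexp c1' E1) (expectation_condexp c2' E2).
rewrite expectation.unlock /Rintegral; congr fine.
have mc (V : T -> R) m : is_condexp P V Y m -> measurable_fun setT (fun w => m (Y w)).
  by case=> mm _ _; exact: measurableT_comp.
apply: ae_eq_integral => //.
- apply/measurable_EFinP; apply: measurable_funM; apply: measurable_funB => //.
    exact: mc c1'.
  exact: mc c2'.
- apply/measurable_EFinP; apply: measurable_funM.
    by apply: measurableT_comp; [exact: measurable_clip|exact: mc c1].
  by apply: measurableT_comp; [exact: measurable_clip|exact: mc c2].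
- apply: filterS2 (filterI a1 b1) (filterI a2 b2) => w [ea1 eb1] [ea2 eb2] _ /=.
  congr EFin; transitivity ((condexp P V1 Y (Y w) - 0) * (condexp P V2 Y (Y w) - 0)) => //.
  by rewrite !subr0 ea1 ea2 !clip_id.
Qed.

End covariance.

(** * The pathwise argument *)

Section pathwise.
Context {R : realType}.

(** Only averages of fourth powers of the errors are controlled, so first and second powers are
    traded for a small constant plus a large multiple of the fourth: for x <= e the constant
    suffices, for x > e both x and x^2 are at most x^4 / e^3. *)
Lemma add_sqr_le_expr4 (x e : R) : 0 <= x -> 0 < e -> e <= 1 ->
  x + x ^+ 2 <= 2 * e + 2 * x ^+ 4 / e ^+ 3.
Proof.
move=> x0 e0 e1; have e3 : 0 < e ^+ 3 by rewrite exprn_gt0.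
have t0 : 0 <= 2 * x ^+ 4 / e ^+ 3.
  by rewrite divr_ge0 ?(ltW e3)// mulr_ge0// exprn_even_ge0.
have [xe|ex] := lerP x e.
  have : x ^+ 2 <= x * e by rewrite expr2 ler_wpM2l.
  have : x * e <= e * 1 by rewrite ler_pM// ltW.
  lra.
have h1 : x <= x ^+ 4 / e ^+ 3.
  rewrite ler_pdivlMr// (exprS x 3) ler_wpM2l// lerXn2r ?nnegrE//; exact: ltW.
have h2 : x ^+ 2 <= x ^+ 4 / e ^+ 3.
  rewrite ler_pdivlMr// (_ : x ^+ 4 = x ^+ 2 * x ^+ 2); last by rewrite -exprD.
  rewrite ler_wpM2l ?sqr_ge0//.
  have : e ^+ 2 <= x ^+ 2 by rewrite lerXn2r ?nnegrE//; exact: ltW.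
  have : e ^+ 3 <= e ^+ 2 by rewrite exprSr ler_piMr// sqr_ge0.
  lra.
rewrite -mulrA; lra.
Qed.

Lemma maxr_lipschitz (x y b : R) : `|Num.max x b - Num.max y b| <= `|y - x|.
Proof.
have h1 := ler_norm (y - x); have h2 : x - y <= `|y - x|.
  by rewrite -opprB (le_trans (ler_norm _))// normrN.
have h3 := normr_ge0 (y - x).
by rewrite ler_norml; case: (lerP x b) => ?; case: (lerP y b) => ?; apply/andP; split; lra.
Qed.

(** The error of the ratio is that of the numerator over the estimated denominator, plus the true
    truncated ratio, bounded by G, times the relative error of the denominator. The estimated
    denominator is at least b, and truncation is 1-Lipschitz. *)
Lemma truncated_ratio_le (gh g fh f b G : R) : 0 < b -> 0 < f -> `|g| <= G * f ->
  `|gh / Num.max fh b - g / Num.max f b| <= `|(gh - g) / b| + G * `|(fh - f) / b|.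
Proof.
move=> b0 f0 gf.
have fb0 : 0 < Num.max f b by rewrite lt_max b0 orbT.
have fhb0 : 0 < Num.max fh b by rewrite lt_max b0 orbT.
have G0 : 0 <= G by rewrite -(pmulr_lge0 _ f0) (le_trans _ gf).
have -> : gh / Num.max fh b - g / Num.max f b =
    (gh - g) / Num.max fh b + g / Num.max f b * ((Num.max f b - Num.max fh b) / Num.max fh b).
  by field; rewrite !gt_eqF.
have inv : (Num.max fh b)^-1 <= b^-1 by rewrite lef_pV2 ?posrE// le_max lexx orbT.
apply: (le_trans (ler_normD _ _)); apply: lerD.
  rewrite !normrM ler_wpM2l// !gtr0_norm ?invr_gt0//.
rewrite normrM ler_pM//.
  rewrite normrM normfV (gtr0_norm fb0) ler_pdivrMr// (le_trans gf)//.
  by rewrite ler_wpM2l// le_max lexx.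
rewrite !normrM !normfV (gtr0_norm fhb0) (gtr0_norm b0) ler_pM//.
  by rewrite invr_ge0 ltW.
exact: maxr_lipschitz.
Qed.

(** The intermediate quantities t_i = g_i / max(f, b) separate the estimation error from the
    truncation error. In the constants, 64 = 8 * 8 comes from applying [expr4_add_le] twice, 128 = 2
    * 64 from [add_sqr_le_expr4], and 16 = 2^4 from the factor 2 in [A]. *)
Lemma truncated_product_le (gh1 g1 gh2 g2 fh f b G e : R) :
  0 < b -> 0 < f -> `|g1| <= G * f -> `|g2| <= G * f -> 0 < e -> e <= 1 ->
  `|gh1 / Num.max fh b * (gh2 / Num.max fh b) - g1 / f * (g2 / f)| <=
  (G + 1) * (2 * e + 128 / e ^+ 3 * (((gh1 - g1) / b) ^+ 4 +
     ((gh2 - g2) / b) ^+ 4 + 16 * G ^+ 4 * ((fh - f) / b) ^+ 4)) +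
  G ^+ 2 * (f < b)%R%:R.
Proof.
move=> b0 f0 gf1 gf2 e0 e1.
have G0 : 0 <= G by rewrite -(pmulr_lge0 _ f0) (le_trans _ gf1).
have a1 := truncated_ratio_le gh1 fh b0 f0 gf1.
have a2 := truncated_ratio_le gh2 fh b0 f0 gf2.
set u1 := (gh1 - g1) / b in a1 *; set u2 := (gh2 - g2) / b in a2 *.
set u0 := (fh - f) / b in a1 a2 *.
set r1 := gh1 / _ in a1 *; set r2 := gh2 / _ in a2 *.
set t1 := g1 / Num.max f b in a1; set t2 := g2 / Num.max f b in a2.
have fb0 : 0 < Num.max f b by rewrite lt_max b0 orbT.
have tG g : `|g| <= G * f -> `|g / Num.max f b| <= G.
  move=> gf; rewrite normrM normfV (gtr0_norm fb0) ler_pdivrMr// (le_trans gf)//.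
  by rewrite ler_wpM2l// le_max lexx.
have T1 : `|t1| <= G := tG _ gf1. have T2 : `|t2| <= G := tG _ gf2.
have q g : `|g| <= G * f -> `|g / f| <= G.
  by move=> gf; rewrite normrM normfV (gtr0_norm f0) ler_pdivrMr.
(* When f < b, the truncated product is (f / b)^2 times the true one, with a factor between 0 and 1;
   otherwise both coincide. *)
have trunc : `|t1 * t2 - g1 / f * (g2 / f)| <= G ^+ 2 * (f < b)%R%:R.
  rewrite /t1 /t2; case: ltP => [fb|bf].
    rewrite mulr1.
    have -> : g1 / b * (g2 / b) - g1 / f * (g2 / f) =
        - (g1 / f * (g2 / f) * (1 - (f / b) ^+ 2)).
      by field; rewrite !gt_eqF.
    rewrite normrN normrM -[leRHS]mulr1 ler_pM//.
      by rewrite normrM expr2 ler_pM// q.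
    have fb1 : f / b <= 1 by rewrite ler_pdivrMr// mul1r ltW.
    have fb2 : 0 <= f / b by rewrite divr_ge0// ltW.
    have : (f / b) ^+ 2 <= 1 by rewrite expr_le1.
    have := sqr_ge0 (f / b); move=> ? ?; rewrite ler_norml; apply/andP; split; lra.
  by rewrite subrr normr0 mulr0.
(* [A] dominates the sum of the two ratio errors; each of them contains G |u0|, hence the 2. *)
pose A := `|u1| + `|u2| + 2 * (G * `|u0|).
have Gu : 0 <= G * `|u0| by rewrite mulr_ge0.
have A0 : 0 <= A by rewrite !addr_ge0// mulr_ge0.
have prod : `|r1 * r2 - t1 * t2| <= (G + 1) * (A + A ^+ 2).
  have -> : r1 * r2 - t1 * t2 = (r1 - t1) * (r2 - t2) + (r1 - t1) * t2 + t1 * (r2 - t2) by ring.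
  have n1 := normr_ge0 u1; have n2 := normr_ge0 u2.
  have p1 : `|r1 - t1| <= A by rewrite /A; lra.
  have p2 : `|r2 - t2| <= A by rewrite /A; lra.
  have p3 : `|r1 - t1| + `|r2 - t2| <= A by rewrite /A; lra.
  have -> : (G + 1) * (A + A ^+ 2) = A * A + G * A + (A + G * A ^+ 2) by ring.
  apply: (@le_trans _ _ (A * A + G * A)); last first.
    by rewrite lerDl addr_ge0// mulr_ge0// sqr_ge0.
  rewrite -addrA (le_trans (ler_normD _ _))// lerD//.
    by rewrite normrM ler_pM.
  rewrite (le_trans (ler_normD _ _))// (normrM (r1 - t1) t2) (normrM t1 (r2 - t2)).
  apply: (@le_trans _ _ (`|r1 - t1| * G + G * `|r2 - t2|)).
    by apply: lerD; [rewrite ler_wpM2l|rewrite ler_wpM2r].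
  by rewrite [X in X + _ <= _]mulrC -mulrDr ler_wpM2l.
have -> : r1 * r2 - g1 / f * (g2 / f) = (r1 * r2 - t1 * t2) + (t1 * t2 - g1 / f * (g2 / f)) by ring.
rewrite (le_trans (ler_normD _ _))// lerD// (le_trans prod)// ler_wpM2l ?addr_ge0//.
rewrite (le_trans (add_sqr_le_expr4 A0 e0 e1))// lerD2l.
have e3 : 0 < e ^+ 3 by rewrite exprn_gt0.
have n4 (x : R) : `|x| ^+ 4 = x ^+ 4 by rewrite -normrX ger0_norm// exprn_even_ge0.
have A4 : A ^+ 4 <= 64 * (u1 ^+ 4 + u2 ^+ 4 + 16 * G ^+ 4 * u0 ^+ 4).
  rewrite (le_trans (expr4_add_le _ _))//.
  have := expr4_add_le `|u1| `|u2|; rewrite !n4.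
  have -> : (2 * (G * `|u0|)) ^+ 4 = 16 * G ^+ 4 * u0 ^+ 4 by rewrite -(n4 u0); ring.
  have : 0 <= 16 * G ^+ 4 * u0 ^+ 4 by apply: mulr_ge0; [apply: mulr_ge0 => //|]; exact: exprn_even_ge0.
  lra.
move: (_ + _ + 16 * _ * _) A4 => W A4.
have -> : 128 / e ^+ 3 * W = 2 * (64 * W) / e ^+ 3 by field; exact: lt0r_neq0.
by rewrite ler_pM2r ?invr_gt0// ler_wpM2l.
Qed.

Definition average (n : nat) (u : nat -> R) : R := n%:R^-1 * \sum_(i < n) u i.

Lemma averageD n u v : average n (fun i => u i + v i) = average n u + average n v.
Proof. by rewrite /average big_split mulrDr. Qed.

Lemma averageZ n a u : average n (fun i => a * u i) = a * average n u.
Proof. by rewrite /average -mulr_sumr mulrCA. Qed.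

Lemma average_cst n a : (0 < n)%N -> average n (fun=> a) = a.
Proof.
move=> n0; rewrite /average sumr_const card_ord -[a *+ n]mulr_natl mulKf//.
by rewrite pnatr_eq0 -lt0n.
Qed.

Lemma le_average n u v : (forall i, u i <= v i) -> average n u <= average n v.
Proof. by move=> uv; rewrite /average ler_wpM2l ?invr_ge0// ler_sum. Qed.

Lemma average_norm_sub n u v :
  `|average n u - average n v| <= average n (fun i => `|u i - v i|).
Proof.
rewrite /average -mulrBr -sumrB normrM ger0_norm ?invr_ge0//.
by rewrite ler_wpM2l ?invr_ge0// ler_norm_sum.
Qed.

(** Deterministic, to be applied to one realisation. The error is cut into four parts of size e / 4:
    the distance of the ideal average from l, the constant from trading powers, the fourth-power
    averages, and the proportion of points with small density. *)
Lemma average_truncated_cvg (gh1 gh2 fh : nat -> nat -> R) (g1 g2 f b : nat -> R)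
    (G l : R) :
  (forall n, 0 < b n) -> b @ \oo --> 0 -> (forall i, 0 < f i) ->
  (forall i, `|g1 i| <= G * f i) -> (forall i, `|g2 i| <= G * f i) ->
  (fun n => average n (fun i => ((gh1 n i - g1 i) / b n) ^+ 4)) @ \oo --> 0 ->
  (fun n => average n (fun i => ((gh2 n i - g2 i) / b n) ^+ 4)) @ \oo --> 0 ->
  (fun n => average n (fun i => ((fh n i - f i) / b n) ^+ 4)) @ \oo --> 0 ->
  (fun n => average n (fun i => g1 i / f i * (g2 i / f i))) @ \oo --> l ->
  (forall e, 0 < e -> exists2 eta, 0 < eta &
     \forall n \near \oo, average n (fun i => (f i < eta)%R%:R) < e) ->
  (fun n => average n (fun i => gh1 n i / Num.max (fh n i) (b n) *
     (gh2 n i / Num.max (fh n i) (b n)))) @ \oo --> l.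
Proof.
move=> b0 b_0 f0 gf1 gf2 A1 A2 A0 B C; apply/cvgrPdist_lt => e e0.
have G0 : 0 <= G by rewrite -(pmulr_lge0 _ (f0 0)) (le_trans _ (gf1 0)).
(* [d] is the trading parameter of [truncated_product_le]; it is fixed before n, so the factor 1 /
   d^3 is a constant in front of averages that tend to 0. *)
pose d := Num.min 1 (e / (8 * (G + 1))).
have d0 : 0 < d by rewrite lt_min ltr01/= divr_gt0// mulr_gt0// ltr_wpDl.
have d1 : d <= 1 by rewrite ge_min lexx.
have dG : (G + 1) * (2 * d) <= e / 4.
  have : d <= e / (8 * (G + 1)) by rewrite ge_min lexx orbT.
  by rewrite ler_pdivlMr ?mulr_gt0 ?ltr_wpDl//; lra.
pose k := (G + 1) * (128 / d ^+ 3).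
pose W n := average n (fun i => ((gh1 n i - g1 i) / b n) ^+ 4) +
  average n (fun i => ((gh2 n i - g2 i) / b n) ^+ 4) +
  16 * G ^+ 4 * average n (fun i => ((fh n i - f i) / b n) ^+ 4).
have W0 : (fun n => k * W n) @ \oo --> 0.
  rewrite -[X in _ --> X](_ : k * (0 + 0 + 16 * G ^+ 4 * 0) = 0); last first.
    by rewrite !(mulr0, addr0).
  apply: cvgM; first exact: cvg_cst.
  apply: cvgD; first exact: cvgD.
  by apply: cvgM; [exact: cvg_cst|].
have e4 : 0 < e / 4 by rewrite divr_gt0.
have G2 : 0 < G ^+ 2 + 1 by rewrite ltr_wpDl// sqr_ge0.
(* Once b n < eta, the moving threshold is replaced by the fixed [eta]. The [+ 1] covers the case G
   = 0. *)
have [eta eta0 Ceta] := C (e / 4 / (G ^+ 2 + 1)) (divr_gt0 e4 G2).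
near=> n.
have n0 : (0 < n)%N by near: n; exact: nbhs_infty_gt.
have hB : `|l - average n (fun i => g1 i / f i * (g2 i / f i))| < e / 4.
  by near: n; move/cvgrPdist_lt : B; exact.
have hW : `|0 - k * W n| < e / 4 by near: n; move/cvgrPdist_lt : W0; exact.
have hb : b n < eta.
  have : `|0 - b n| < eta by near: n; move/cvgrPdist_lt : b_0; exact.
  by rewrite sub0r normrN gtr0_norm.
have hC : average n (fun i => (f i < eta)%R%:R) < e / 4 / (G ^+ 2 + 1).
  by near: n; exact: Ceta.
set u := fun i => gh1 n i / Num.max (fh n i) (b n) * (gh2 n i / Num.max (fh n i) (b n)).
set v := fun i => g1 i / f i * (g2 i / f i) in hB.
have huv : `|average n v - average n u| <= e / 4 + k * W n +
    G ^+ 2 * average n (fun i => (f i < eta)%R%:R).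
  rewrite distrC (le_trans (average_norm_sub _ _ _))//.
  apply: (@le_trans _ _ (average n (fun i =>
    ((G + 1) * (2 * d) + k * ((((gh1 n i - g1 i) / b n) ^+ 4 +
     ((gh2 n i - g2 i) / b n) ^+ 4) + 16 * G ^+ 4 * ((fh n i - f i) / b n) ^+ 4)) +
    G ^+ 2 * (f i < eta)%R%:R))).
    apply: le_average => i.
    apply: (le_trans (truncated_product_le _ _ _ (b0 n) (f0 i) (gf1 i) (gf2 i) d0 d1)).
    apply: lerD; first by rewrite mulrDr lerD2l mulrA.
    rewrite ler_wpM2l ?sqr_ge0// ler_nat.
    by case: ltP => // fb; rewrite (lt_trans fb hb).
  set x1 := fun i => ((gh1 n i - g1 i) / b n) ^+ 4.
  set x2 := fun i => ((gh2 n i - g2 i) / b n) ^+ 4.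
  set x0 := fun i => ((fh n i - f i) / b n) ^+ 4.
  rewrite (averageD n (fun i => (G + 1) * (2 * d) + k * (x1 i + x2 i + 16 * G ^+ 4 * x0 i))).
  rewrite averageZ lerD2r (averageD n (fun=> _)) average_cst// averageZ.
  rewrite (averageD n (fun i => x1 i + x2 i)) (averageD n x1) averageZ.
  by rewrite -/(W n) lerD2r.
have hG : G ^+ 2 * average n (fun i => (f i < eta)%R%:R) <= e / 4.
  move: hC; rewrite ltr_pdivlMr// mulrDr mulr1.
  have : 0 <= average n (fun i => (f i < eta)%R%:R).
    by rewrite /average mulr_ge0 ?invr_ge0// sumr_ge0.
  rewrite [_ * G ^+ 2]mulrC; lra.
have -> : l - average n u = (l - average n v) + (average n v - average n u) by ring.
rewrite (le_lt_trans (ler_normD _ _))//.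
move: hW; rewrite sub0r normrN => hW; have := ler_norm (k * W n).
lra.
Unshelve. all: by end_near. Qed.

End pathwise.

(** * Kernel averages at the sample points *)

Section kernel_averages.
Context {d : measure_display} {T : measurableType d} {R : realType}.
Variable P : probability T R.
Context {d1 : measure_display} {S : measurableType d1}.

Lemma measurable_partial_Rintegral (kappa : S * S -> R) (Z0 : T -> S) :
  measurable_fun setT Z0 -> bounded_measurable kappa ->
  measurable_fun setT (fun s => \int[P]_w kappa (s, Z0 w)).
Proof.
move=> mZ0 [mk [M kM]].
(* Adding the bound M makes the integrand nonnegative, so the Tonelli measurability statement
   applies; M is subtracted afterwards. *)
pose F (p : S * T) : \bar R := (kappa (p.1, Z0 p.2) + M)%:E.
have mF : measurable_fun setT F.
  apply/measurable_EFinP; apply: measurable_funD => //.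
  apply: measurableT_comp => //; apply: measurable_fun_pair => //.
  exact: measurableT_comp.
have F0 p : (0 <= F p)%E.
  rewrite lee_fin -lerBlDr sub0r.
  by move: (kM (p.1, Z0 p.2)); rewrite ler_norml => /andP[].
have mI := measurable_fun_fubini_tonelli_F (m2 := P) F mF F0.
rewrite (_ : (fun s => _) = fun s => fine (fubini_F P F s) - M).
  apply: measurable_funB => //.
  exact: (measurableT_comp (fine_measurable measurableT)).
apply/funext => s; rewrite /fubini_F /F/=.
have bs : bounded_measurable (fun w => kappa (s, Z0 w)).
  split; last by exists M.
  by apply: measurableT_comp => //; exact: measurable_fun_pair.
have := bounded_RintegralD P bs (bounded_measurable_cst M).
by rewrite Rintegral_probability_cst {1}/Rintegral => ->; rewrite addrK.
Qed.

Variables (Z : nat -> T -> S) (Z0 : T -> S).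
Hypothesis mZ : forall i, measurable_fun setT (Z i).
Hypothesis mZ0 : measurable_fun setT Z0.
Hypothesis indZ : mutually_independent P Z.
Hypothesis lawZ : forall i, same_law P (Z i) Z0.
Variables (xi y : S -> R) (K q : R -> R) (B M C e : R) (h b : nat -> R).
Hypothesis mxi : measurable_fun setT xi.
Hypothesis my : measurable_fun setT y.
Hypothesis mK : measurable_fun setT K.
Hypothesis xiB : forall s, `|xi s| <= B.
Hypothesis KM : forall u, `|K u| <= M.
Hypothesis h0 : forall n, 0 < h n.
Hypothesis b0 : forall n, 0 < b n.
Hypothesis e0 : 0 < e.
Hypothesis bias : forall t z, 0 < t -> t < e ->
  `|\int[P]_w (xi (Z0 w) * t^-1 * K ((z - y (Z0 w)) / t)) - q z| <= C * t ^+ 4.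
Hypothesis h_0 : h @ \oo --> 0.
Hypothesis h4b_0 : (fun n => h n ^+ 4 / b n) @ \oo --> 0.
Hypothesis hb_sum : cvgn (series (fun n => (h n ^+ 4 * b n ^+ 4 * n%:R ^+ 2)^-1)).

Let kern n (p : S * S) := xi p.2 * (h n)^-1 * K ((y p.1 - y p.2) / h n).
(** By independence, the conditional mean of an off-diagonal kernel term given that the evaluation
    point is [s]. Equality of laws makes it the same for every observation, so [psi n] is centered
    for all k. *)
Let mean n s := \int[P]_w kern n (s, Z0 w).
Let psi n (p : S * S) := kern n p - mean n p.1.
Let bound n := B * (h n)^-1 * M.

Let kernB n p : `|kern n p| <= bound n.
Proof.
rewrite /kern /bound normrM; apply: ler_pM => //.
rewrite normrM; apply: ler_pM => //.
by rewrite ger0_norm// invr_ge0 ltW.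
Qed.

Let mkern n : measurable_fun setT (kern n).
Proof.
apply: measurable_funM.
  by apply: measurable_funM => //; exact: measurableT_comp.
apply: measurableT_comp => //; apply: measurable_funM => //.
by apply: measurable_funB; exact: measurableT_comp.
Qed.

Let bkern n : bounded_measurable (kern n).
Proof. by split; [exact: mkern|exists (bound n)]. Qed.

Let mmean n : measurable_fun setT (mean n).
Proof. exact: measurable_partial_Rintegral. Qed.

Let bkern_section n (W : T -> S) s : measurable_fun setT W ->
  bounded_measurable (fun w => kern n (s, W w)).
Proof.
move=> mW; split; last by exists (bound n).
by apply: measurableT_comp => //; exact: measurable_fun_pair.
Qed.

Let meanB n s : `|mean n s| <= bound n.
Proof.
have bk := bkern_section n s mZ0.
rewrite (le_trans (le_normr_Rintegral _ _))//.
  exact: bounded_measurable_integrable.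
rewrite -[leRHS](Rintegral_probability_cst P); apply: bounded_le_Rintegral => //.
  by case: bk => mk [N kN]; split; [exact: measurableT_comp|exists N => w; rewrite normr_id].
exact: bounded_measurable_cst.
Qed.

Let psiB n p : `|psi n p| <= 2 * bound n.
Proof.
rewrite (le_trans (ler_normB _ _))// mulr_natl mulr2n; exact: lerD.
Qed.

Let mpsi n : measurable_fun setT (psi n).
Proof. by apply: measurable_funB => //; exact: measurableT_comp. Qed.

Let psi0 n k s : \int[P]_w psi n (s, Z k w) = 0.
Proof.
rewrite /psi bounded_RintegralD/=; [|exact: bkern_section|exact: bounded_measurable_cst].
rewrite Rintegral_probability_cst.
rewrite (@same_law_Rintegral _ _ _ P _ _ _ _ (fun z => kern n (s, z)) _ mZ0 (lawZ k)) ?subrr//.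
split; last by exists (bound n).
by apply: measurableT_comp => //; exact: measurable_fun_pair.
Qed.

(** Stated for a general weight [xi] and target [q], to serve twice: weight 1 and target f, then the
    clipped j-th coordinate and target g_j. The centered part satisfies |psi| <= 2 B M / h, whence
    the factor 40 (2 B M)^4 in its expectation. *)
Lemma kernel_average_ae_cvg : {ae P, forall w, (fun n => average n (fun i =>
  ((n%:R^-1 * \sum_(k < n) xi (Z k w) * (h n)^-1 * K ((y (Z i w) - y (Z k w)) / h n)
    - q (y (Z i w))) / b n) ^+ 4)) @ \oo --> 0}.
Proof.
pose N n w := average n (fun i => (n%:R^-1 * \sum_(k < n) psi n (Z i w, Z k w)) ^+ 4).
pose D n w := b n ^- 4 * N n w.
have bN n : bounded_measurable (N n).
  apply: bounded_measurableM; first exact: bounded_measurable_cst.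
  apply: bounded_measurable_sum => i; apply: bounded_measurableX.
  apply: bounded_measurableM; first exact: bounded_measurable_cst.
  apply: bounded_measurable_sum => k; split; last by exists (2 * bound n).
  by apply: measurableT_comp => //; exact: measurable_fun_pair.
have bD n : bounded_measurable (D n).
  by apply: bounded_measurableM => //; exact: bounded_measurable_cst.
have D0 n w : 0 <= D n w.
  apply: mulr_ge0; first by rewrite invr_ge0 exprn_even_ge0.
  by rewrite mulr_ge0 ?invr_ge0// sumr_ge0// => i _; rewrite exprn_even_ge0.
have ED n : \int[P]_w D n w <=
    40 * (2 * B * M) ^+ 4 * (h n ^+ 4 * b n ^+ 4 * n%:R ^+ 2)^-1.
  rewrite bounded_RintegralZ//.
  have := centered_pair_average_fourth_moment mZ indZ n (mpsi n) (psiB n) (psi0 n).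
  rewrite -(ler_pM2l (_ : 0 < b n ^- 4)); last by rewrite invr_gt0 exprn_gt0.
  move=> /le_trans; apply.
  rewrite le_eqVlt; apply/orP; left; apply/eqP; rewrite /bound.
  rewrite (invfM (h n ^+ 4 * b n ^+ 4)); move: (n%:R ^+ 2)^-1 => n2.
  by field; rewrite !gt_eqF.
have sD : cvgn (series (fun n => 40 * (2 * B * M) ^+ 4 * (h n ^+ 4 * b n ^+ 4 * n%:R ^+ 2)^-1)).
  exact: (@is_cvg_seriesZ R (fun n => (h n ^+ 4 * b n ^+ 4 * n%:R ^+ 2)^-1)
    (40 * (2 * B * M) ^+ 4) hb_sum).
have := ae_cvg0 bD D0 ED sD; apply: filterS => w Dw.
(* The share of the bias: it is deterministic and bounds every sample point alike, so averaging
   leaves it unchanged. *)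
pose bd n := (C * (h n ^+ 4 / b n)) ^+ 4.
have bd0 : bd @ \oo --> 0.
  rewrite -[X in _ --> X](_ : (C * 0) ^+ 4 = 0); last by rewrite mulr0 expr0n.
  have Ch0 : (fun n => C * (h n ^+ 4 / b n)) @ \oo --> C * 0.
    by apply: cvgM; [exact: cvg_cst|].
  exact: cvg_comp Ch0 (@exprn_continuous _ 4 (C * 0)).
have up : (fun n => 8 * (D n w + bd n)) @ \oo --> 0.
  rewrite -[X in _ --> X](_ : 8 * (0 + 0) = 0); last by rewrite addr0 mulr0.
  by apply: cvgM; [exact: cvg_cst|apply: cvgD].
apply: (squeeze_cvgr _ (cvg_cst 0) up); near=> n; apply/andP; split.
  by rewrite /average mulr_ge0 ?invr_ge0// sumr_ge0// => i _; rewrite exprn_even_ge0.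
have n0 : (0 < n)%N by near: n; exact: nbhs_infty_gt.
have he : h n < e.
  have : `|0 - h n| < e by near: n; move/cvgrPdist_lt : h_0; exact.
  by rewrite sub0r normrN gtr0_norm.
have n4 (x : R) : `|x| ^+ 4 = x ^+ 4 by rewrite -normrX ger0_norm// exprn_even_ge0.
rewrite /D /N -averageZ -[bd n](average_cst _ n0) -averageD -averageZ.
apply: le_average => i.
rewrite -exprVn -exprMn -[X in X ^+ 4 + _]mulrC -n4.
pose z := y (Z i w).
have -> : n%:R^-1 * (\sum_(k < n) xi (Z k w) * (h n)^-1 * K ((z - y (Z k w)) / h n)) - q z =
   n%:R^-1 * (\sum_(k < n) psi n (Z i w, Z k w)) + (mean n (Z i w) - q z).
  have -> : \sum_(k < n) psi n (Z i w, Z k w) =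
      \sum_(k < n) kern n (Z i w, Z k w) - n%:R * mean n (Z i w).
    by rewrite /psi /= sumrB sumr_const card_ord mulr_natl.
  rewrite mulrBr mulKf; last by rewrite pnatr_eq0 -lt0n.
  by rewrite addrA subrK.
rewrite n4 mulrDl (le_trans (expr4_add_le _ _))// ler_pM2l// lerD2l.
have bi : `|mean n (Z i w) - q z| <= C * h n ^+ 4 by exact: (bias z (h0 n) he).
rewrite -n4 /bd lerXn2r ?nnegrE//.
  by rewrite mulrA divr_ge0 ?(ltW (b0 n))// (le_trans _ bi).
rewrite normrM normfV (gtr0_norm (b0 n)) mulrA.
by rewrite ler_pM2r ?invr_gt0.
Unshelve. all: by end_near. Qed.

End kernel_averages.

(** * Rates of the bandwidth and of the truncation level *)

Section rates.
Context {R : realType}.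

Lemma cvg_powRN (c : R) : 0 < c -> (fun n : nat => n%:R `^ (- c) : R) @ \oo --> 0.
Proof.
move=> c0; apply/cvgrPdist_lt => e e0; near=> n.
have n0 : (0 < n)%N by near: n; exact: nbhs_infty_gt.
have nR0 : 0 < n%:R :> R by rewrite ltr0n.
have hn : (e^-1) `^ c^-1 < n%:R by near: n; exact: nbhs_infty_gtr.
rewrite sub0r normrN ger0_norm ?powR_ge0// powRN invf_plt ?posrE ?powR_gt0//.
have := @gt0_ltr_powR _ c c0 ((e^-1) `^ c^-1) n%:R.
rewrite !nnegrE powR_ge0 (ltW nR0) => /(_ isT isT hn).
by rewrite -powRrM mulVf ?gt_eqF// powRr1// invr_ge0 ltW.
Unshelve. all: by end_near. Qed.

Lemma asymp_powR_bounds (u : nat -> R) (c : R) :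
  asymp u (fun n => n%:R `^ (- c)) ->
  exists m M, 0 < m /\ \forall n \near \oo,
    m * n%:R `^ (- c) <= u n /\ u n <= M * n%:R `^ (- c).
Proof.
move=> [l l0 ul]; exists (l / 2), (l + l / 2); split; first by rewrite divr_gt0.
near=> n; have n0 : (0 < n)%N by near: n; exact: nbhs_infty_gt.
have p0 : 0 < n%:R `^ (- c) :> R by rewrite powR_gt0// ltr0n.
have : `|l - u n / n%:R `^ (- c)| < l / 2.
  by near: n; move/cvgrPdist_lt : ul; apply; rewrite divr_gt0.
rewrite ltr_norml => /andP[h1 h2]; split.
  by rewrite -ler_pdivlMr//; lra.
by rewrite -ler_pdivrMr//; lra.
Unshelve. all: by end_near. Qed.

Variables (h b : nat -> R) (c1 c2 : R).
Hypothesis h0 : forall n, 0 < h n.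
Hypothesis b0 : forall n, 0 < b n.
Hypothesis c10 : 0 < c1.
Hypothesis c12 : c2 < 4 * c1.
Hypothesis c12' : c1 < 1 / 4 - c2.
Hypothesis hasy : asymp h (fun n => n%:R `^ (- c1)).
Hypothesis basy : asymp b (fun n => n%:R `^ (- c2)).

Lemma bandwidth_cvg0 : h @ \oo --> 0.
Proof.
have [m [M [m0 hM]]] := asymp_powR_bounds hasy.
have M0 : (fun n => M * n%:R `^ (- c1)) @ \oo --> 0.
  by rewrite -[X in _ --> X](mulr0 M); apply: cvgM; [exact: cvg_cst|exact: cvg_powRN].
apply: (squeeze_cvgr _ (cvg_cst 0) M0); apply: filterS hM => n [_ hn].
by rewrite hn andbT ltW.
Qed.

Let powR4 (n : nat) (c : R) : (n%:R `^ c) ^+ 4 = n%:R `^ (4 * c) :> R.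
Proof. by rewrite -powR_mulrn ?powR_ge0// -powRrM mulrC. Qed.

Lemma bandwidth_bias_cvg0 : (fun n => h n ^+ 4 / b n) @ \oo --> 0.
Proof.
have [m [M [m0 hM]]] := asymp_powR_bounds hasy.
have [m' [M' [m'0 bM]]] := asymp_powR_bounds basy.
have C0 : (fun n => M ^+ 4 / m' * n%:R `^ (- (4 * c1 - c2))) @ \oo --> 0.
  rewrite -[X in _ --> X](mulr0 (M ^+ 4 / m')).
  by apply: cvgM; [exact: cvg_cst|apply: cvg_powRN; rewrite subr_gt0].
apply: (squeeze_cvgr _ (cvg_cst 0) C0).
apply: filterS3 (nbhs_infty_gt 0) hM bM => n n0 [_ hn] [bn _].
have nR0 : 0 < n%:R :> R by rewrite ltr0n.
apply/andP; split; first by rewrite divr_ge0 ?exprn_ge0// ltW.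
have -> : M ^+ 4 / m' * n%:R `^ (- (4 * c1 - c2)) =
    (M * n%:R `^ (- c1)) ^+ 4 / (m' * n%:R `^ (- c2)).
  rewrite exprMn powR4 invfM -powRN opprK mulrACA -powRD; last by rewrite (gt_eqF nR0) implybT.
  by congr (_ * _ `^ _); ring.
have p0 : 0 < m' * n%:R `^ (- c2) by rewrite mulr_gt0// powR_gt0.
apply: ler_pM; [by rewrite exprn_ge0// ltW|by rewrite invr_ge0 ltW| |].
  by rewrite lerXn2r ?nnegrE ?(ltW (h0 n))// (le_trans _ hn)// ltW.
by rewrite lef_pV2 ?posrE.
Qed.

Lemma bandwidth_variance_summable :
  cvgn (series (fun n => (h n ^+ 4 * b n ^+ 4 * n%:R ^+ 2)^-1)).
Proof.
have [m [M [m0 hM]]] := asymp_powR_bounds hasy.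
have [m' [M' [m'0 bM]]] := asymp_powR_bounds basy.
(* The decay exponent of 1 / (h^4 b^4 n^2); p > 1 is exactly [c12']. The factor 2^p below pays for
   replacing n by n + 1 <= 2 n. *)
pose p := 2 - 4 * c1 - 4 * c2.
apply: (@near_pseries_cvg _ _ ((m ^+ 4 * m' ^+ 4)^-1 * 2 `^ p) p).
- by move: c12'; rewrite /p; lra.
- move=> n; rewrite invr_ge0 mulr_ge0 ?sqr_ge0// mulr_ge0// exprn_even_ge0//.
apply: filterS3 (nbhs_infty_gt 0) hM bM => n n0 [hn _] [bn _].
have nR0 : 0 < n%:R :> R by rewrite ltr0n.
have mn : 0 < m * n%:R `^ (- c1) by rewrite mulr_gt0// powR_gt0.
have mn' : 0 < m' * n%:R `^ (- c2) by rewrite mulr_gt0// powR_gt0.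
apply: (@le_trans _ _ ((m ^+ 4 * m' ^+ 4)^-1 * n%:R `^ (- p))).
  have -> : (m ^+ 4 * m' ^+ 4)^-1 * n%:R `^ (- p) =
      ((m * n%:R `^ (- c1)) ^+ 4 * (m' * n%:R `^ (- c2)) ^+ 4 * n%:R ^+ 2)^-1.
    rewrite (powRN _ p) -invfM; congr (_^-1).
    rewrite !exprMn !powR4 -(powR_mulrn 2 (ltW nR0)).
    have -> : p = 4 * - c1 + 4 * - c2 + 2 by rewrite /p; ring.
    rewrite (powRD (r := _ + _)); last by rewrite (gt_eqF nR0) implybT.
    rewrite powRD; last by rewrite (gt_eqF nR0) implybT.
    by ring.
  rewrite lef_pV2 ?posrE; last 2 first.
  - by apply: mulr_gt0; [apply: mulr_gt0|]; apply: exprn_gt0.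
  - by apply: mulr_gt0; [apply: mulr_gt0|]; apply: exprn_gt0.
  rewrite ler_wpM2r ?sqr_ge0// ler_pM ?exprn_ge0 ?(ltW mn) ?(ltW mn')//.
    by rewrite lerXn2r ?nnegrE ?(ltW mn) ?(ltW (h0 n)).
  by rewrite lerXn2r ?nnegrE ?(ltW mn') ?(ltW (b0 n)).
rewrite -[leRHS]mulrA ler_wpM2l//.
  by rewrite invr_ge0 mulr_ge0// exprn_even_ge0.
rewrite !powRN ler_pdivlMr ?powR_gt0 ?ltr0n// mulrC ler_pdivrMr ?powR_gt0//.
rewrite -powRM//; apply: ge0_ler_powR.
- by move: c12'; rewrite /p; lra.
- by rewrite nnegrE.
- by rewrite nnegrE mulr_ge0.
- rewrite -natr1 (_ : 2 * n%:R = n%:R + n%:R); last by ring.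
  by rewrite lerD2l ler1n.
Qed.

End rates.

(** * Proof of the consistency theorem *)

Lemma cvg_mx {R : realType} m n (F : nat -> 'M[R]_(m, n)) (M : 'M[R]_(m, n)) :
  (forall i j, (fun k => F k i j) @ \oo --> M i j) -> F @ \oo --> M.
Proof.
move=> FM A [Q Qnbhs QA].
have : \forall k \near \oo, forall i j, Q i j (F k i j).
  apply: filter_forall => i; apply: filter_forall => j.
  exact: (FM i j _ (Qnbhs i j)).
by apply: filterS => k Qk; apply: QA.
Qed.

Lemma ae_forall_fin {d : measure_display} {T : measurableType d} {R : realType}
    (mu : {measure set T -> \bar R}) (I : finType) (Q : I -> T -> Prop) :
  (forall i, {ae mu, forall w, Q i w}) -> {ae mu, forall w, forall i, Q i w}.
Proof. by move=> aeQ; apply: filter_forall. Qed.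

(** Carries the almost sure bounds known for (Y, X) over to each sample point. *)
Lemma ae_same_law {d : measure_display} {T : measurableType d} {R : realType}
    (P : probability T R) {d1 : measure_display} {S : measurableType d1}
    (Z1 Z2 : T -> S) (A : set S) :
  measurable_fun setT Z1 -> measurable_fun setT Z2 -> same_law P Z1 Z2 ->
  measurable A -> {ae P, forall w, A (Z2 w)} -> {ae P, forall w, A (Z1 w)}.
Proof.
move=> m1 m2 law mA A2.
have mC (Z : T -> S) : measurable_fun setT Z -> measurable (Z @^-1` ~` A).
  by move=> mZ; rewrite -[X in measurable X]setTI; apply: mZ => //; exact: measurableC.
exists (Z1 @^-1` ~` A); split; [exact: mC| |by []].
rewrite law; last exact: measurableC.
apply/negligibleP; first exact: mC.
by move: A2; rewrite /almost_everywhere.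
Qed.

Section density_means.
Context {d : measure_display} {T : measurableType d} {R : realType}.
Variable P : probability T R.
Notation lambda := (@lebesgue_measure R).
Local Notation BR := (measurableTypeR R).
Variables (Y : T -> R) (f : R -> R).
Hypothesis mY : measurable_fun setT Y.
Hypothesis fdens : density_of P lambda Y f.

Lemma density_Rintegral (phi : R -> R) : bounded_measurable phi ->
  \int[P]_w phi (Y w) = \int[lambda]_y (phi y * f y).
Proof.
move=> bphi; rewrite /Rintegral; congr fine.
have mY' : @measurable_fun _ _ T BR setT Y by exact: mY.
have mphi : @measurable_fun _ _ BR R setT phi by case: bphi.
apply: (density_integral mY' fdens mphi).
apply: bounded_measurable_integrable; exact: bounded_measurable_comp.
Qed.

Variables (V : T -> R) (G : R) (fVY : R * R -> R).
Hypothesis mV : measurable_fun setT V.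
Hypothesis VG : {ae P, forall w, `|V w| <= G}.
Hypothesis fVYdens : density_of P (lambda \x lambda)%E (fun w => (V w, Y w)) fVY.
Hypothesis mg : measurable_fun setT (gfun fVY).

Lemma gfun_Rintegral (phi : R -> R) : bounded_measurable phi ->
  \int[P]_w (clip G (V w) * phi (Y w)) = \int[lambda]_y (phi y * gfun fVY y).
Proof.
move=> bphi; have [_ E] := gfun_integral mV mY VG fVYdens mg bphi.
rewrite /Rintegral -E; congr fine.
have mphiY : measurable_fun setT (phi \o Y) by case: bphi => mphi _; exact: measurableT_comp.
apply: ae_eq_integral => //.
- apply/measurable_EFinP; apply: measurable_funM => //.
  by apply: measurableT_comp => //; exact: measurable_clip.
- by apply/measurable_EFinP; apply: measurable_funM.
- by apply: filterS VG => w VGw _; rewrite clip_id.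
Qed.

Hypothesis fpos : forall y, 0 < f y.

(** Since f is positive everywhere, the decreasing events f(Y) < 1 / (n + 1) have an empty
    intersection, and continuity from above makes their probabilities tend to 0. *)
Lemma small_density_Rintegral e : 0 < e -> exists2 eta, 0 < eta &
  \int[P]_w ((f (Y w) < eta)%R%:R) < e.
Proof.
move=> e0; have [mf _ _] := fdens.
have mf' : @measurable_fun _ _ R R setT f by exact: mf.
pose A n := [set w | f (Y w) < n.+1%:R^-1].
have mA n : measurable (A n).
  rewrite -[A n]setTI; apply: measurable_fun_ltr => //.
  exact: measurableT_comp mf' mY.
have EA n : \int[P]_w ((f (Y w) < n.+1%:R^-1)%R%:R) = fine (P (A n)).
  rewrite /Rintegral; congr fine.
  have -> : P (A n) = (\int[P]_w (\1_(A n) w)%:E)%E by rewrite integral_indic// setIT.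
  apply: eq_integral => w _; congr EFin; rewrite indicE.
  by have -> : (w \in A n) = (f (Y w) < n.+1%:R^-1) by apply/idP/idP; rewrite inE.
have A0 : \bigcap_n A n = set0.
  rewrite -subset0 => w Aw; have := Aw (Num.truncn (f (Y w))^-1) I.
  rewrite /A/= ltNge => /negP; apply; rewrite -[leRHS]invrK.
  by rewrite lef_pV2 ?posrE ?invr_gt0 ?ltr0n// ltW// truncnS_gt.
have cA : P \o A @ \oo --> P (\bigcap_n A n).
  apply: nonincreasing_cvg_mu => //.
  - by rewrite (le_lt_trans (probability_le1 _ _)) ?ltry.
  - exact: bigcapT_measurable.
  - move=> m n mn; apply/subsetPset => w /= /lt_le_trans; apply.
    by rewrite lef_pV2 ?posrE ?ltr0n// ler_nat.
have /fine_cvg/cvgrPdist_lt/(_ e e0)[N _ hN] : P \o A @ \oo --> 0%:E.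
  by rewrite A0 measure0 in cA.
exists N.+1%:R^-1; first by rewrite invr_gt0 ltr0n.
have := hN N (leqnn N); rewrite EA sub0r normrN /= ger0_norm// fine_ge0//.
Qed.

End density_means.

Lemma abs_tnth_le_enorm (R : realType) (d : nat) (x : d.-tuple R) (j : 'I_d) :
  `|tnth x j| <= enorm (col_of_tuple x).
Proof.
rewrite -sqrtr_sqr ler_sqrt; last by apply: sumr_ge0 => i _; exact: sqr_ge0.
rewrite (bigD1 j)//= mxE lerDl; apply: sumr_ge0 => i _; exact: sqr_ge0.
Qed.

Unset Implicit Arguments.

Theorem theorem3 (R : realType) (disp : measure_display)
  (Omega : measurableType disp) (P : probability Omega R)
  (N d : nat) (hN : (1 <= N)%N) (hNd : (N < d)%N)
  (* the regression model; X is standardised: centred, with identity covariance *)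
  (X : {RV P >-> d.-tuple R}) (Y eps : {RV P >-> R})
  (beta : 'I_N -> 'cV[R]_d) (F : 'rV[R]_(N + 1) -> R)
  (hmodel : {ae P, forall w, Y w =
     F (row_mx (\row_k ((beta k)^T *m col_of_tuple (X w)) 0 0)
               (const_mx (eps w)))})
  (heps : independent_pair P X eps)
  (hmeanX : forall j, ('E_P[coordinate X j] = 0)%E)
  (hcovX : covmx P (coordinate X) = 1%:M)
  (* the densities of Y and of the pairs (X^(j), Y) *)
  (f : R -> R) (hf : density_of P lebesgue_measure Y f)
  (hfpos : forall y, 0 < f y)
  (fXY : 'I_d -> R * R -> R)
  (hfXY : forall j, density_of P (lebesgue_measure \x lebesgue_measure)%E
     (fun w => (coordinate X j w, Y w)) (fXY j))
  (g : 'I_d -> R -> R) (hg : g = fun j => gfun (fXY j))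
  (Rj : 'I_d -> R -> R) (hRj : Rj = fun j y => g j y / f y)
  (* the sample, the kernel, the bandwidth and the truncation level *)
  (Ys : nat -> {RV P >-> R}) (Xs : nat -> {RV P >-> d.-tuple R})
  (hiid : iid_sample P (fun w => (Y w, X w)) (fun i w => (Ys i w, Xs i w)))
  (K : R -> R)
  (hK1 : (\int[lebesgue_measure]_u (K u)%:E)%E = 1%E)
  (h b : nat -> R) (hh : forall n, 0 < h n) (hb : forall n, 0 < b n)
  (hb0 : b @ \oo --> 0)
  (* (1) *)
  (G : R) (hG : 0 < G)
  (hXG : {ae P, forall w, enorm (col_of_tuple (X w)) <= G})
  (* (2) *)
  (hfbd : has_ubound (range f))
  (* (3) *)
  (hf3 : times_derivable 3 f) (hg3 : forall j, times_derivable 3 (g j))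
  (U : set R) (hU : nbhs (0 : R) U) (c : R) (hc : 0 < c)
  (hf3lip : forall u y, U u ->
     `|derive1n 3 f (y + u) - derive1n 3 f y| <= c * `|u|)
  (hg3lip : forall u y j, U u ->
     `|derive1n 3 (g j) (y + u) - derive1n 3 (g j) y| <= c * `|u|)
  (* (4) *)
  (hRlip : forall k l u y, U u ->
     `|Rj k (y + u) * Rj l (y + u) - Rj k y * Rj l y| <= c * `|u|)
  (* (5) *)
  (r : nat) (hr : (6 < r)%N)
  (alpha : R) (halpha0 : 0 < alpha) (halpha1 : alpha <= 1)
  (L : R) (hL : 0 < L) (hbeta : 7 < r%:R + alpha)
  (hgr : forall j, times_derivable r (g j))
  (hgrhol : forall j x y,
     `|derive1n r (g j) x - derive1n r (g j) y| <= L * `|x - y| `^ alpha)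
  (* (6) *)
  (hKcont : continuous K)
  (hKsupp : support_of K = [set u | -1 <= u <= 1])
  (hKsym : forall u, K (- u) = K u)
  (hKbd : has_ubound (range (fun u => `|K u|)))
  (hKord : forall k, (1 <= k <= r)%N ->
     (\int[lebesgue_measure]_u (u ^+ k * K u)%:E)%E = 0%E)
  (hKint : (\int[lebesgue_measure]_u `|K u|%:E < +oo)%E)
  (hKmom : (\int[lebesgue_measure]_u
     (`|u| `^ (r%:R + alpha) * `|K u|)%:E < +oo)%E)
  (* (7) *)
  (c1 c2 : R) (hc1 : 0 < c1) (hc2 : 0 < c2) (hc2' : c2 < 1 / 10)
  (hc12 : 1 / 8 + c2 / 4 < c1) (hc12' : c1 < 1 / 4 - c2)
  (hhn : asymp h (fun n => n%:R `^ (- c1)))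
  (hbn : asymp b (fun n => n%:R `^ (- c2))) :
  {ae P, forall w,
    (fun n => Lambdahat K h b (fun i => Ys i w) (fun i => Xs i w) n)
      @ \oo --> Lambda P X Y}.
Proof.
subst g Rj; have [indZ lawZ] := hiid.
pose Z i w := (Ys i w, Xs i w); pose Z0 w := (Y w, X w).
have mZ i : measurable_fun setT (Z i) by exact: measurable_fun_pair.
have mZ0 : measurable_fun setT Z0 by exact: measurable_fun_pair.
have mV j : measurable_fun setT (coordinate X j).
  by apply: (measurableT_comp (measurable_tnth j)).
have mY : measurable_fun setT Y by [].
have [M KM] : exists M, forall u, `|K u| <= M.
  by case: hKbd => M hM; exists M => u; apply: hM; exists u.
have [e e0 eU] : exists2 e, 0 < e & forall u, `|u| < e -> U u.
  move/nbhs_ballP : hU => [e e0 eU]; exists e => // u ue; apply: eU.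
  by rewrite /ball /= sub0r normrN.
have intK : \int[lebesgue_measure]_u K u = 1 by rewrite /Rintegral hK1.
have momentK k : (1 <= k <= 3)%N -> \int[lebesgue_measure]_u (u ^+ k * K u) = 0.
  move=> /andP[k1 k3]; have kr : (k <= r)%N := leq_trans k3 (leq_trans (isT : (3 <= 7)%N) hr).
  by rewrite /Rintegral hKord// k1.
have VG j : {ae P, forall w, `|coordinate X j w| <= G}.
  apply: filterS hXG => w; apply: le_trans; exact: abs_tnth_le_enorm.
have cg j : continuous (gfun (fXY j)).
  by move=> y; apply/differentiable_continuous/derivable1_diffP; exact: (hg3 j 0).
have cf : continuous f.
  by move=> y; apply/differentiable_continuous/derivable1_diffP; exact: (hf3 0).
have mg j : measurable_fun setT (gfun (fXY j)) by exact: continuous_measurable_fun.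
have mf : measurable_fun setT f by exact: continuous_measurable_fun.
have mK : measurable_fun setT K by exact: continuous_measurable_fun.
have bphi (t z : R) : bounded_measurable (fun y : R => t^-1 * K ((z - y) / t)).
  apply: bounded_measurableM; first exact: bounded_measurable_cst.
  split; last by exists M.
  by apply: measurableT_comp => //; apply: measurable_funM => //; exact: measurable_funB.
(* The factor 1 is the weight [xi] in the form expected by [kernel_average_ae_cvg]. *)
have bias0 (t z : R) : 0 < t -> t < e ->
    `|\int[P]_w (1 * t^-1 * K ((z - Y w) / t)) - f z| <= 2 * M * c * t ^+ 4.
  move=> t0 te; under eq_Rintegral do rewrite mul1r.
  rewrite (density_Rintegral mY hf (bphi t z)).
  have lip u y : `|u| < e -> `|derive1n 3 f (y + u) - derive1n 3 f y| <= c * `|u|.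
    by move=> ue; apply: hf3lip; exact: eU.
  exact: (kernel_bias hKcont hKsupp KM intK momentK z (ltW hc) hf3 lip t0 te).
have biasg j (t z : R) : 0 < t -> t < e ->
    `|\int[P]_w (clip G (tnth (X w) j) * t^-1 * K ((z - Y w) / t)) - gfun (fXY j) z|
    <= 2 * M * c * t ^+ 4.
  move=> t0 te; under eq_Rintegral do rewrite -mulrA.
  rewrite (gfun_Rintegral mY (mV j) (VG j) (hfXY j) (mg j) (bphi t z)).
  have lip u y : `|u| < e -> `|derive1n 3 (gfun (fXY j)) (y + u) -
      derive1n 3 (gfun (fXY j)) y| <= c * `|u|.
    by move=> ue; apply: hg3lip; exact: eU.
  exact: (kernel_bias hKcont hKsupp KM intK momentK z (ltW hc) (hg3 j) lip t0 te).
(* The lower bound on [c1] amounts to 4 c1 > 1/2 + c2. *)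
have c24 : c2 < 4 * c1 by move: hc12 hc2; lra.
have h_0 := bandwidth_cvg0 hh hc1 hhn.
have h4b_0 := bandwidth_bias_cvg0 hh hb c24 hhn hbn.
have hb_sum := bandwidth_variance_summable hh hb hc12' hhn hbn.
have avg0 : {ae P, forall w, (fun n => average n (fun i =>
    ((n%:R^-1 * \sum_(k < n) 1 * (h n)^-1 * K ((Ys i w - Ys k w) / h n)
      - f (Ys i w)) / b n) ^+ 4)) @ \oo --> 0}.
  have one1 (s : R * d.-tuple R) : `|1 : R| <= 1 by rewrite normr1.
  have m1 : measurable_fun setT (fun _ : R * d.-tuple R => 1 : R) by exact: measurable_cst.
  exact: (kernel_average_ae_cvg mZ mZ0 indZ lawZ m1 measurable_fst
    mK one1 KM hh hb e0 bias0 h_0 h4b_0 hb_sum).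
have avgg j : {ae P, forall w, (fun n => average n (fun i =>
    ((n%:R^-1 * \sum_(k < n) clip G (tnth (Xs k w) j) * (h n)^-1 *
      K ((Ys i w - Ys k w) / h n) - gfun (fXY j) (Ys i w)) / b n) ^+ 4)) @ \oo --> 0}.
  have mclip : measurable_fun setT (fun s : R * d.-tuple R => clip G (tnth s.2 j)).
    apply: (measurableT_comp (measurable_clip G)).
    by apply: (measurableT_comp (measurable_tnth j)).
  have clipG (s : R * d.-tuple R) : `|clip G (tnth s.2 j)| <= G by exact/clip_le/ltW.
  exact: (kernel_average_ae_cvg mZ mZ0 indZ lawZ mclip measurable_fst
    mK clipG KM hh hb e0 (biasg j) h_0 h4b_0 hb_sum).
pose m j y := gfun (fXY j) y / f y.
have cm j : is_condexp P (coordinate X j) Y (m j).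
  exact: (is_condexp_gfun (mV j) mY (VG j) (hfXY j) (mg j) hf hfpos).
have mm j : measurable_fun setT (m j) by case: (cm j).
have XsG : {ae P, forall w, forall i j, `|tnth (Xs i w) j| <= G}.
  apply: ae_foralln => i; apply: ae_forall_fin => j.
  pose A := [set s : R * d.-tuple R | `|tnth s.2 j| <= G].
  have mA : measurable A.
    rewrite -[A]setTI; apply: measurable_fun_ler => //.
    apply: measurableT_comp => //.
    by apply: (measurableT_comp (measurable_tnth j)).
  exact: (ae_same_law (mZ i) mZ0 (lawZ i) mA (VG j)).
(* This is |g_j| <= G f at the sample points, obtained from the bound on X by way of the conditional
   expectation. *)
have mG : {ae P, forall w, forall i j, `|m j (Ys i w)| <= G}.
  apply: ae_foralln => i; apply: ae_forall_fin => j.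
  pose A := [set s : R * d.-tuple R | `|m j s.1| <= G].
  have mA : measurable A.
    rewrite -[A]setTI; apply: measurable_fun_ler => //.
    apply: measurableT_comp => //.
    exact: (measurableT_comp (mm j)).
  exact: (ae_same_law (mZ i) mZ0 (lawZ i) mA
    (is_condexp_bounded (mV j) mY (VG j) (cm j))).
have slln j k : {ae P, forall w, (fun n => average n (fun i =>
    clip G (m j (Ys i w)) * clip G (m k (Ys i w)))) @ \oo -->
    \int[P]_w (clip G (m j (Y w)) * clip G (m k (Y w)))}.
  pose phi (s : R * d.-tuple R) := clip G (m j s.1) * clip G (m k s.1).
  have bm l : bounded_measurable (fun s : R * d.-tuple R => clip G (m l s.1)).
    apply: (bounded_measurable_clip (ltW hG)).
    exact: (measurableT_comp (mm l)).
  have bphi2 : bounded_measurable phi by exact: bounded_measurableM.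
  have phiZ l : \int[P]_w phi (Z l w) = \int[P]_w phi (Z0 w).
    exact: (same_law_Rintegral (mZ l) mZ0 (lawZ l) bphi2).
  exact: (bounded_SLLN mZ indZ bphi2 phiZ).
(* The tolerance runs through the values 1 / (q + 1), so that a countable union of null sets
   suffices. *)
pose rarely_small (q : nat) w := exists2 eta : R, 0 < eta &
  \forall n \near \oo, @average R n (fun i => (f (Ys i w) < eta)%R%:R) < q.+1%:R^-1.
have small : {ae P, forall w, forall q, rarely_small q w}.
  apply: ae_foralln => q; have q0 : 0 < q.+1%:R^-1 :> R by rewrite invr_gt0 ltr0n.
  have [eta eta0 Peta] := small_density_Rintegral mY hf hfpos q0.
  pose phi (s : R * d.-tuple R) : R := (f s.1 < eta)%R%:R.
  have bphi2 : bounded_measurable phi.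
    split; last by exists 1 => s; rewrite /phi; case: (_ < _); rewrite ?normr1 ?normr0.
    rewrite (_ : phi = \1_[set s | f s.1 < eta]).
      apply: measurable_indic; rewrite -[X in measurable X]setTI.
      apply: measurable_fun_ltr => //; exact: (measurableT_comp mf).
    apply/funext => s; rewrite /phi indicE; congr (_%:R).
    by congr nat_of_bool; apply/idP/idP; rewrite inE.
  have phiZ l : \int[P]_w phi (Z l w) = \int[P]_w phi (Z0 w).
    exact: (same_law_Rintegral (mZ l) mZ0 (lawZ l) bphi2).
  apply: filterS (bounded_SLLN mZ indZ bphi2 phiZ) => w Hw.
  exists eta => //; exact: (cvgr_lt _ Hw _ Peta).
have sllnA := ae_forall_fin (fun j => ae_forall_fin (slln j)).
have avggA := ae_forall_fin avgg.
apply: filter_app XsG; apply: filter_app mG; apply: filter_app sllnA.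
(* From here on [w] is one outcome outside all the exceptional null sets, and the argument is
   deterministic. *)
apply: filterS3 avg0 avggA small => w w0 wg wsmall wS wm wX.
apply: cvg_mx => k l.
rewrite /Lambda /covmx mxE.
rewrite (covariance_condexp mY (mV k) (mV l) (VG k) (VG l)
  (hmeanX k) (hmeanX l) (cm k) (cm l)).
pose ys i := Ys i w; pose xs i := Xs i w.
have -> : (fun n => Lambdahat K h b ys xs n k l) = (fun n => average n (fun i =>
    ghat K h ys xs n k (ys i) / Num.max (fhat K h ys n (ys i)) (b n) *
    (ghat K h ys xs n l (ys i) / Num.max (fhat K h ys n (ys i)) (b n)))).
  apply/funext => n; rewrite /Lambdahat mxE summxE; congr (_ * _).
  by apply: eq_bigr => i _; rewrite mxE big_ord1 !mxE.
(* By [wX] all sample points of this outcome are bounded by G, so the estimator coincides with its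
   clipped form. *)
have ghatE j n i : ghat K h ys xs n j (ys i) = n%:R^-1 * \sum_(k < n)
    clip G (tnth (Xs k w) j) * (h n)^-1 * K ((Ys i w - Ys k w) / h n).
  by rewrite /ghat; congr (_ * _); apply: eq_bigr => q _; rewrite clip_id.
have fhatE n i : fhat K h ys n (ys i) = n%:R^-1 * \sum_(k < n)
    1 * (h n)^-1 * K ((Ys i w - Ys k w) / h n).
  by rewrite /fhat; congr (_ * _); apply: eq_bigr => q _; rewrite mul1r.
have gf j i : `|gfun (fXY j) (ys i)| <= G * f (ys i).
  have := wm i j; rewrite /m normrM normfV (gtr0_norm (hfpos _)).
  by rewrite ler_pdivrMr.
apply: (@average_truncated_cvg _ _ _ _ (fun i => gfun (fXY k) (ys i))
  (fun i => gfun (fXY l) (ys i)) (fun i => f (ys i)) b G _ hb hb0) => //.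
- move: (wg k); rewrite (_ : (fun n => _) = (fun n => average n (fun i =>
    ((ghat K h ys xs n k (ys i) - gfun (fXY k) (ys i)) / b n) ^+ 4)))//.
  by apply/funext => n; congr average; apply/funext => i; rewrite ghatE.
- move: (wg l); rewrite (_ : (fun n => _) = (fun n => average n (fun i =>
    ((ghat K h ys xs n l (ys i) - gfun (fXY l) (ys i)) / b n) ^+ 4)))//.
  by apply/funext => n; congr average; apply/funext => i; rewrite ghatE.
- move: w0; rewrite (_ : (fun n => _) = (fun n => average n (fun i =>
    ((fhat K h ys n (ys i) - f (ys i)) / b n) ^+ 4)))//.
  by apply/funext => n; congr average; apply/funext => i; rewrite fhatE.
- move: (wS k l); rewrite (_ : (fun n => _) = (fun n => average n (fun i =>
    gfun (fXY k) (ys i) / f (ys i) * (gfun (fXY l) (ys i) / f (ys i)))))//.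
  by apply/funext => n; congr average; apply/funext => i; rewrite !clip_id.
- move=> e' e'0; have [eta eta0 Heta] := wsmall (Num.truncn e'^-1).
  exists eta => //; apply: filterS Heta => n /lt_le_trans; apply.
  by rewrite -[leRHS]invrK lef_pV2 ?posrE ?invr_gt0 ?ltr0n// ltW// truncnS_gt.
Qed.
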